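(* Let $n>3$, let $\mathfrak{g}=\mathfrak{so}(n,\mathbb{C})$, and let $K=SO(n-1,\mathbb{C})$ with Lie algebra $\mathfrak{k}=\mathfrak{so}(n-1,\mathbb{C})$. Let $\mathfrak{b}\subset\mathfrak{g}$ be a Borel subalgebra and suppose that the $K$-orbit $K\cdot\mathfrak{b}$ is closed in the flag variety $\mathcal{B}$ of $\mathfrak{g}$. Let $\mathfrak{n}=[\mathfrak{b},\mathfrak{b}]$ be the nilradical of $\mathfrak{b}$. Then $$\mathfrak{z}_{\mathfrak{k}}(\mathfrak{n}\cap\mathfrak{k})\cap\mathfrak{z}_{\mathfrak{g}}(\mathfrak{n})\neq 0,$$ where $\mathfrak{z}_{\mathfrak{g}}(\mathfrak{n})$ is the centralizer of $\mathfrak{n}$ in $\mathfrak{g}$, and $\mathfrak{z}_{\mathfrak{k}}(\mathfrak{n}\cap\mathfrak{k})$ is the centralizer of $\mathfrak{n}\cap\mathfrak{k}$ in $\mathfrak{k}$.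
   Context: $\mathfrak{so}(n,\mathbb{C})$ is the Lie algebra of a nondegenerate symmetric bilinear form on $\mathbb{C}^n$, $\mathfrak{k}=\mathfrak{so}(n-1,\mathbb{C})$ is embedded as the annihilator of a fixed non-isotropic vector in $\mathbb{C}^n$ (the fixed points of the involution of $\mathfrak{g}$ given by conjugation by the orthogonal reflection in that vector), and $K=SO(n-1,\mathbb{C})\subset SO(n,\mathbb{C})$ is the corresponding connected subgroup. $\mathcal{B}$ is the variety of Borel subalgebras of $\mathfrak{g}$, on which $K$ acts by the adjoint action. *)

(* Defs.v *)
From HB Require Import structures.
From mathcomp Require Import all_boot all_algebra.
From mathcomp Require Import reals complex mpoly.
Set Implicit Arguments.
Unset Strict Implicit.
Unset Printing Implicit Defensive.
Import GRing.Theory.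
Local Open Scope ring_scope.

Section LieAlgebra.
Variables (F : fieldType) (n : nat).
Implicit Types (U V W g b : {vspace 'M[F]_n}) (x y : 'M[F]_n).

Definition lie_bracket x y : 'M[F]_n := x *m y - y *m x.

Lemma lie_bracket_is_linear x : linear (lie_bracket x).
Proof.
move=> a u w; rewrite /lie_bracket mulmxDr mulmxDl -scalemxAr -scalemxAl.
by rewrite scalerBr opprD addrACA.
Qed.
HB.instance Definition _ x :=
  GRing.isLinear.Build F 'M[F]_n 'M[F]_n _ (lie_bracket x)
    (lie_bracket_is_linear x).

Lemma lie_bracketC x y : lie_bracket x y = - lie_bracket y x.
Proof. by rewrite /lie_bracket opprB. Qed.

(* [U, V], the linear span of all brackets (see [lie_prod_subP]). *)
Definition lie_prod U V : {vspace 'M[F]_n} :=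
  <<[seq lie_bracket x y | x <- vbasis U, y <- vbasis V]>>%VS.

Definition lie_centralizer V U : {vspace 'M[F]_n} :=
  (V :&: \bigcap_(i < \dim U) lker (linfun (lie_bracket (vbasis U)`_i)))%VS.

Definition lie_subalgebra U : Prop := (lie_prod U U <= U)%VS.

Definition derived_series U k : {vspace 'M[F]_n} :=
  iter k (fun W => lie_prod W W) U.

Definition lie_solvable U : Prop := exists k, derived_series U k = 0%VS.

Definition borel_subalgebra g b : Prop :=
  [/\ (b <= g)%VS, lie_subalgebra b, lie_solvable b &
      forall b', (b' <= g)%VS -> lie_subalgebra b' -> lie_solvable b' ->
        (b <= b')%VS -> b' = b].

Lemma mem_lie_centralizer V U x :
  reflect (x \in V /\ forall y, y \in U -> lie_bracket x y = 0)
          (x \in lie_centralizer V U).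
Proof.
rewrite memv_cap; apply: (iffP andP) => -[xV xU]; split=> //.
  move=> y yU; rewrite (coord_vbasis yU) linear_sum big1 // => i _.
  rewrite linearZ /= lie_bracketC.
  move/subv_bigcapP: xU => /(_ i isT).
  by rewrite -memvE memv_ker lfunE /= => /eqP->; rewrite oppr0 scaler0.
rewrite memvE; apply/subv_bigcapP => i _; rewrite -memvE memv_ker lfunE /=.
by rewrite lie_bracketC xU ?oppr0 // vbasis_mem // mem_nth // size_tuple.
Qed.

Lemma mem_lie_prod U V x y :
  x \in U -> y \in V -> lie_bracket x y \in lie_prod U V.
Proof.
move=> xU yV; rewrite (coord_vbasis yV) linear_sum; apply: memv_suml => j _.
rewrite linearZ memvZ //= lie_bracketC memvN (coord_vbasis xU) linear_sum.
apply: memv_suml => i _; rewrite linearZ memvZ //= lie_bracketC memvN.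
by apply/memv_span/allpairs_f; rewrite mem_nth ?size_tuple.
Qed.

Lemma lie_prod_subP U V W :
  reflect (forall x y, x \in U -> y \in V -> lie_bracket x y \in W)
          (lie_prod U V <= W)%VS.
Proof.
apply: (iffP idP) => [/subvP sW x y xU yV | sW]; first exact/sW/mem_lie_prod.
apply/span_subvP => _ /allpairsP[[x y] /= [xU yV ->]].
by apply: sW; apply: vbasis_mem.
Qed.

End LieAlgebra.

(* S is the Gram matrix of a bilinear form on column vectors and v is a vector
   in F^n. *)
Section Orthogonal.
Variables (F : fieldType) (n : nat) (S : 'M[F]_n) (v : 'cV[F]_n).
Implicit Types (x g : 'M[F]_n) (V b : {vspace 'M[F]_n}).

Definition skew_defect x : 'M[F]_n := x^T *m S + S *m x.

Lemma skew_defect_is_linear : linear skew_defect.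
Proof.
move=> a u w; rewrite /skew_defect linearP mulmxDl mulmxDr -scalemxAl.
by rewrite -scalemxAr scalerDr addrACA.
Qed.
HB.instance Definition _ :=
  GRing.isLinear.Build F 'M[F]_n 'M[F]_n _ skew_defect skew_defect_is_linear.

Definition so : {vspace 'M[F]_n} := lker (linfun skew_defect).

Definition so_annihilator : {vspace 'M[F]_n} :=
  (so :&: lker (linfun (mulmxr v : 'M[F]_n -> 'cV[F]_n)))%VS.

Lemma mem_so x : (x \in so) = (x^T *m S + S *m x == 0).
Proof. by rewrite memv_ker lfunE. Qed.

Lemma mem_so_annihilator x :
  (x \in so_annihilator) = (x \in so) && (x *m v == 0).
Proof. by rewrite memv_cap; congr andb; rewrite memv_ker lfunE. Qed.

Definition SO_group g : Prop := g^T *m S *m g = S /\ \det g = 1.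

(* For v non-isotropic this is the special orthogonal group of the orthogonal
   complement of v, that is, the connected subgroup with Lie algebra
   [so_annihilator]. *)
Definition SO_stabilizer g : Prop := SO_group g /\ g *m v = v.

Definition adjoint_act g V : {vspace 'M[F]_n} :=
  (linfun (mulmxr (invmx g) \o mulmx g : 'M[F]_n -> 'M[F]_n) @: V)%VS.

Definition SO_stabilizer_orbit b V : Prop :=
  exists g, SO_stabilizer g /\ V = adjoint_act g b.

End Orthogonal.

Section Zariski.
Variables (F : fieldType) (n : nat).
Implicit Types (V : {vspace 'M[F]_n}) (X Z : {vspace 'M[F]_n} -> Prop).

(* A minor is taken for every map from 'I_d to the columns, not only for the
   increasing ones; the additional coordinates are zero or, up to sign, equal to
   those of the increasing maps. *)
Definition plucker_index d := #|{ffun 'I_d -> 'I_(n * n)}|.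

Definition frame d V : 'M[F]_(d, n * n) :=
  \matrix_(i < d) mxvec (vbasis V)`_i.

(* The Plucker coordinates of V when d = \dim V, computed in the basis [vbasis V]
   (another basis multiplies all of them by the same nonzero scalar). *)
Definition plucker d V : 'I_(plucker_index d) -> F :=
  fun k => \det (colsub (enum_val k : {ffun 'I_d -> 'I_(n * n)}) (frame d V)).

(* Z is relatively Zariski closed in X, where X is a subset of the disjoint union
   over d of the Grassmannians of d-dimensional subspaces, each of them embedded
   in projective space by its Plucker coordinates. *)
Definition zariski_closed_in X Z : Prop :=
  exists I : forall d, {mpoly F[plucker_index d]} -> Prop,
    (forall d f, I d f -> exists e, f \is e.-homog) /\
    (forall V, X V ->
       (Z V <-> forall f, I (\dim V) f -> f.@[plucker (d := \dim V) V] = 0)).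

End Zariski.

(* Main.v *)
Require Import Defs.
From HB Require Import structures.
From mathcomp Require Import all_boot all_algebra.
From mathcomp Require Import ring.
From mathcomp Require Import reals complex mpoly.
Set Implicit Arguments.
Unset Strict Implicit.
Unset Printing Implicit Defensive.
Import GRing.Theory Num.Theory.
Local Open Scope ring_scope.

(* By Lie's theorem b stabilizes an isotropic line <e>, and an isotropic line
   <u> of the quadratic space perp e / e.  If e were not orthogonal to v, write
   v = w + f with f isotropic and orthogonal to w, and w orthogonal to e.  The
   unipotent group E(s) generated by f /\ w sends v to w + (1 + s <v, v>) f,
   which for 1 + s <v, v> <> 0 is also the image of v under a torus stabilizing
   b.  Hence E(-s) b lies in the K-orbit of b for all s but one.  The Plucker
   coordinates of E(-s) b are polynomial in s, so if the orbit is closed it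
   contains E(-s) b for the remaining s too; as <e> is the only b-stable
   isotropic line, this forces e to be orthogonal to v.  For n > 4 the same
   argument applies to u, and the highest root vector e /\ u annihilates v.  For
   n = 4 every e /\ w with w in perp e centralizes the nilradical, and w can be
   chosen orthogonal to v. *)

(** * Column subspaces and the matrices mapping one into another *)

Section ColumnSubspaces.
Variables (F : fieldType) (n : nat).
Implicit Types (U V W : {vspace 'cV[F]_n}) (u w : 'cV[F]_n) (x : 'M[F]_n).

Lemma mulmx_ext m (x y : 'M[F]_(m, n)) :
  (forall u : 'cV_n, x *m u = y *m u) -> x = y.
Proof.
move=> xy; apply/matrixP => i j; have := xy (delta_mx j 0).
by rewrite -!colE => /colP/(_ i); rewrite !mxE.
Qed.

(** Some coordinate of [u - projv U u] is nonzero; the same coordinate of [w - projv U w], rescaled,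
    is the required functional of [w]. *)
Lemma separating_row U u : u \notin U ->
  exists a : 'rV[F]_n,
    (forall w, w \in U -> (a *m w) 0 0 = 0) /\ (a *m u) 0 0 = 1.
Proof.
move=> uU; have : u - projv U u != 0.
  by apply: contraNneq uU => /subr0_eq->; apply: memv_proj.
case/cV0Pn => i ui0; pose c := ((u - projv U u) i 0)^-1.
pose a : 'rV[F]_n := \row_j (c * (delta_mx j 0 - projv U (delta_mx j 0)) i 0).
have aE w : (a *m w) 0 0 = c * (w - projv U w) i 0.
  have {2 3}-> : w = \sum_j w j 0 *: (delta_mx j 0 : 'cV_n).
    by rewrite [LHS]matrix_sum_delta; apply: eq_bigr => j _; rewrite big_ord1.
  rewrite linear_sum -sumrB summxE mulr_sumr mxE; apply: eq_bigr => j _.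
  by rewrite linearZ -scalerBr !mxE mulrC mulrCA.
exists a; split=> [w wU|]; rewrite aE ?mulVf //.
by rewrite projv_id // subrr mxE mulr0.
Qed.

(** Being a subspace of matrices, it turns stability and triangularity of a Lie algebra into
    inclusions. *)
Definition transporter U W : {vspace 'M[F]_n} :=
  \bigcap_(i < \dim U)
    (linfun (mulmxr (vbasis U)`_i : 'M[F]_n -> 'cV[F]_n) @^-1: W)%VS.

Lemma transporterP U W x :
  reflect (forall u, u \in U -> x *m u \in W) (x \in transporter U W).
Proof.
apply: (iffP idP) => [xUW u uU | xUW].
  rewrite (coord_vbasis uU) mulmx_sumr; apply: memv_suml => i _.
  rewrite -scalemxAr memvZ //.
  have /subv_bigcapP/(_ i isT) := xUW.
  by rewrite -memvE -memv_preim lfunE.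
rewrite memvE; apply/subv_bigcapP => i _; rewrite -memvE -memv_preim lfunE /=.
by rewrite xUW // vbasis_mem // mem_nth // size_tuple.
Qed.

Lemma transporter_mono U U' W W' :
  (U' <= U)%VS -> (W <= W')%VS -> (transporter U W <= transporter U' W')%VS.
Proof.
move=> /subvP sU /subvP sW; apply/subvP => x /transporterP xUW.
by apply/transporterP => u /sU/xUW/sW.
Qed.

End ColumnSubspaces.

(** * Solvable matrix Lie algebras and maximality of Borel subalgebras *)

Section LieTheory.
Variables (F : fieldType) (n : nat).
Implicit Types (a b c : {vspace 'M[F]_n}) (x y : 'M[F]_n).
Implicit Types (U W L : {vspace 'cV[F]_n}) (u w e : 'cV[F]_n).

Lemma lie_prodS a a' b b' :
  (a <= a')%VS -> (b <= b')%VS -> (lie_prod a b <= lie_prod a' b')%VS.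
Proof.
move=> /subvP sa /subvP sb; apply/lie_prod_subP => x y /sa xa /sb yb.
exact: mem_lie_prod.
Qed.

Lemma derived_seriesSr a k :
  derived_series a k.+1 = derived_series (lie_prod a a) k.
Proof. by rewrite /derived_series iterSr. Qed.

Lemma derived_seriesS a b k :
  (a <= b)%VS -> (derived_series a k <= derived_series b k)%VS.
Proof. by move=> ab; elim: k => //= k IH; apply: lie_prodS. Qed.

Lemma lie_solvableS a b : (a <= b)%VS -> lie_solvable b -> lie_solvable a.
Proof.
move=> ab [k bk]; exists k; apply/eqP; rewrite -subv0 -bk.
exact: derived_seriesS.
Qed.

Lemma lie_subalgebraP a : lie_subalgebra a <->
  (forall x y, x \in a -> y \in a -> lie_bracket x y \in a).
Proof. by split=> [/lie_prod_subP|] // ?; apply/lie_prod_subP. Qed.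

Lemma lie_bracketDl x y z :
  lie_bracket (x + y) z = lie_bracket x z + lie_bracket y z.
Proof. by rewrite /lie_bracket mulmxDl mulmxDr opprD addrACA. Qed.

Lemma lie_bracket_mul x y u :
  lie_bracket x y *m u = x *m (y *m u) - y *m (x *m u).
Proof. by rewrite mulmxBl !mulmxA. Qed.

(** Elements of the [k]-th derived algebra lower the index of the flag by [k + 1], so the [m]-th
    derived algebra kills everything. *)
Lemma lie_solvable_flag (f : nat -> {vspace 'cV[F]_n}) m a :
  f 0%N = 0%VS -> f m = fullv -> (forall i, f i <= f i.+1)%VS ->
  (forall i, a <= transporter (f i.+1) (f i))%VS -> lie_solvable a.
Proof.
move=> f0 fm fS af.
have aT k i : (derived_series a k <= transporter (f (i + k.+1)%N) (f i))%VS.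
  elim: k i => [|k IH] i; first by rewrite addn1.
  apply/lie_prod_subP => x y xk yk; apply/transporterP => u.
  rewrite addnS -addSn => fu; rewrite lie_bracket_mul.
  have step z t : z \in derived_series a k -> t \in derived_series a k ->
      z *m (t *m u) \in f i.
    move=> zk tk; apply/(transporterP _ _ _ (subvP (IH i) _ zk)).
    have := transporterP _ _ _ (subvP (IH i.+1) _ tk) u fu.
    apply: (subvP _) => {IH fu}; rewrite addnS -addSn.
    elim: k {xk yk zk tk} => [|k /subv_trans]; first by rewrite addn0 subvv.
    by apply; rewrite addnS fS.
  by rewrite memvB ?step.
exists m; apply/eqP; rewrite -subv0; apply/subvP => x xm.
have {}xm : x \in transporter fullv 0.
  have /subvP/(_ x xm) := aT m 0%N; rewrite f0 add0n.
  by apply: (subvP (transporter_mono _ (subvv _)) x); rewrite -fm fS.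
rewrite memv0; apply/eqP/mulmx_ext => u.
have /transporterP/(_ u (memvf _)) := xm.
by rewrite memv0 mul0mx => /eqP.
Qed.

Lemma lie_solvable_derived a : lie_solvable (lie_prod a a) -> lie_solvable a.
Proof. by case=> k ak; exists k.+1; rewrite derived_seriesSr. Qed.

Lemma derived_series_sub a k :
  lie_subalgebra a -> (derived_series a k <= a)%VS.
Proof.
move=> sa; elim: k => //= k IH; apply: subv_trans sa; exact: lie_prodS.
Qed.

Lemma lie_prod_add a c : (lie_prod a c <= c)%VS -> lie_subalgebra c ->
  (lie_prod (a + c) (a + c) <= lie_prod a a + c)%VS.
Proof.
move=> /lie_prod_subP ac /lie_subalgebraP cc; apply/lie_prod_subP => p q.
move=> /memv_addP[x xa [y yc ->]] /memv_addP[z za [t tc ->]] {p q}.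
rewrite linearD /= !lie_bracketDl -addrA memv_add ?mem_lie_prod //.
apply: memvD; first by rewrite lie_bracketC memvN ac.
by apply: memvD; [apply: ac | apply: cc].
Qed.

(** Modulo [c] the derived series of [a + c] is that of [a]; once it has entered [c], the derived
    series of [c] finishes it. *)
Lemma lie_solvable_add a c : lie_subalgebra a -> (lie_prod a c <= c)%VS ->
  lie_subalgebra c -> lie_solvable a -> lie_solvable c -> lie_solvable (a + c).
Proof.
move=> sa ac sc [k ak] [l cl]; exists (l + k)%N.
have ack : (derived_series (a + c) k <= c)%VS.
  suff : (derived_series (a + c) k <= derived_series a k + c)%VS.
    by rewrite ak add0v.
  elim: k {ak} => //= k IH; apply: subv_trans (lie_prodS IH IH) _.
  apply: lie_prod_add => //; apply: subv_trans ac; apply: lie_prodS => //.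
  exact: derived_series_sub.
apply/eqP; rewrite -subv0 -cl /derived_series iterD.
exact: derived_seriesS.
Qed.

(** The sum [b + c] is again a solvable subalgebra, so maximality of [b] absorbs [c]. *)
Lemma borel_normalized g b c : borel_subalgebra g b -> (c <= g)%VS ->
  (lie_prod b c <= c)%VS -> lie_subalgebra c -> lie_solvable c -> (c <= b)%VS.
Proof.
case=> bg sb solb bmax cg bc sc solc.
rewrite -(bmax (b + c)%VS) ?addvSl ?addvSr //; first by rewrite subv_add bg.
- apply: subv_trans (lie_prod_add bc sc) _.
  by rewrite subv_add addvSr (subv_trans sb) ?addvSl.
- exact: lie_solvable_add.
Qed.

(* The elements of a act on L / U by commuting scalars. *)
Lemma lie_prod_transporter_line a U e :
  (a <= transporter U U)%VS ->
  (a <= transporter <[e]> (U + <[e]>))%VS ->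
  (lie_prod a a <= transporter (U + <[e]>) U)%VS.
Proof.
move=> /subvP aU /subvP ae.
have acte x : x \in a -> exists k, x *m e - k *: e \in U.
  move=> /ae/transporterP/(_ e (memv_line e))/memv_addP[u uU [w]].
  by case/vlineP=> k -> ->; exists k; rewrite // addrK.
apply/lie_prod_subP => x y xa ya.
have /transporterP xU := aU x xa; have /transporterP yU := aU y ya.
apply/transporterP => w /memv_addP[u uU [_ /vlineP[k ->] ->]].
rewrite mulmxDr -scalemxAr memvD ?memvZ //.
  by rewrite lie_bracket_mul; apply: memvB; [apply/xU/yU | apply/yU/xU].
have [p pU] := acte x xa; have [q qU] := acte y ya.
have -> : lie_bracket x y *m e =
    (x *m (y *m e - q *: e) + q *: (x *m e - p *: e)) -
    (y *m (x *m e - p *: e) + p *: (y *m e - q *: e)).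
  rewrite lie_bracket_mul !mulmxBr -!scalemxAr !scalerBr !scalerA (mulrC q p).
  by rewrite !addrA !subrK opprB addrA subrK.
apply: memvB; apply: memvD.
- exact: xU.
- exact: memvZ.
- exact: yU.
- exact: memvZ.
Qed.

End LieTheory.

(** * Lie's theorem relative to a stable subspace *)

Section LieTheorem.
Variables (C : numClosedFieldType) (n : nat).
Implicit Types (a b : {vspace 'M[C]_n}) (x y : 'M[C]_n).
Implicit Types (U W : {vspace 'cV[C]_n}) (u w : 'cV[C]_n).

(** By Cayley-Hamilton a product of factors [y - z] kills [w]. When the factors are applied one at a
    time, the last vector outside [U] is an eigenvector modulo [U]. *)
Lemma relative_eigenvector (W : 'cV[C]_n -> Prop) U y w :
  (forall u c, W u -> W (y *m u - c *: u)) -> W w -> w \notin U ->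
  exists u, [/\ W u, u \notin U & exists c, y *m u - c *: u \in U].
Proof.
move=> Wy Ww wU; case: n => [|m] in W U y w Wy Ww wU *.
  by move: wU; rewrite [w]flatmx0 mem0v.
have [r yr] := closed_field_poly_normal (char_poly y).
have {yr} : (\prod_(z <- r) (y - z%:M)) *m w \in U.
  have := Cayley_Hamilton y.
  rewrite yr (monicP (char_poly_monic y)) scale1r rmorph_prod.
  under eq_bigr do rewrite rmorphB /= horner_mx_X horner_mx_C.
  by move->; rewrite mul0mx mem0v.
have Wr s : W ((\prod_(z <- s) (y - z%:M)) *m w).
  elim: s => [|z s IH]; first by rewrite big_nil mul1mx.
  by rewrite big_cons -mulmxA mulmxBl mul_scalar_mx; apply: Wy.
elim: r => [|z r IH]; first by rewrite big_nil mul1mx (negPf wU).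
have [/IH //|zU] := boolP ((\prod_(z <- r) (y - z%:M)) *m w \in U).
rewrite big_cons -mulmxA mulmxBl mul_scalar_mx => zrU.
by exists ((\prod_(z <- r) (y - z%:M)) *m w); split=> //; exists z.
Qed.

Section Weight.
Variables (a : {vspace 'M[C]_n}) (y : 'M[C]_n) (U : {vspace 'cV[C]_n}).
Variables (u : 'cV[C]_n) (wt : 'M[C]_n -> C).
Hypotheses (ay : forall x, x \in a -> lie_bracket x y \in a).
Hypotheses (aU : forall x w, x \in a -> w \in U -> x *m w \in U).
Hypotheses (yU : forall w, w \in U -> y *m w \in U).
Hypotheses (uU : u \notin U).
Hypothesis wtP : forall x, x \in a -> x *m u - wt x *: u \in U.

Let pw k := iter k (mulmx y) u.
(** The chain of the classical proof of Lie's theorem, taken relative to [U]: the first [k] iterates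
    of [y] on [u] are adjoined. *)
Fixpoint krylov k : {vspace 'cV[C]_n} :=
  if k is j.+1 then (krylov j + <[pw j]>)%VS else U.

Lemma krylovS k : (krylov k <= krylov k.+1)%VS.
Proof. exact: addvSl. Qed.

Lemma mem_krylov k : pw k \in krylov k.+1.
Proof. by apply: (subvP (addvSr _ _)); apply: memv_line. Qed.

Lemma krylov_mul k w : w \in krylov k -> y *m w \in krylov k.+1.
Proof.
elim: k w => [|k IH] w; first by move/yU; apply: (subvP (krylovS 0)).
case/memv_addP => t tk [_ /vlineP[c ->] ->].
rewrite mulmxDr -scalemxAr; apply: memvD.
  by apply: (subvP (krylovS _)); apply: IH.
exact/memvZ/(mem_krylov k.+1).
Qed.

(** Moving [x] past one factor [y] costs [lie_bracket x y]; each of the [k + 1] such terms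
    contributes its weight to the coefficient of [pw k]. *)
Lemma krylov_weight k x : x \in a ->
  x *m pw k.+1 - wt x *: pw k.+1 - (k.+1%:R * wt (lie_bracket x y)) *: pw k
    \in krylov k.
Proof.
elim: k x => [|k IH] x xa; pose z := lie_bracket x y; have za : z \in a := ay xa.
  rewrite mul1r; have -> : x *m pw 1 - wt x *: pw 1 - wt z *: pw 0 =
      y *m (x *m u - wt x *: u) + (z *m u - wt z *: u).
    rewrite /pw /= lie_bracket_mul mulmxBr -scalemxAr addrA.
    by rewrite [y *m _ - _ + _]addrC addrA subrK.
  by rewrite memvD ?yU ?wtP.
have -> : x *m pw k.+2 - wt x *: pw k.+2 - (k.+2%:R * wt z) *: pw k.+1 =
    y *m (x *m pw k.+1 - wt x *: pw k.+1 - (k.+1%:R * wt z) *: pw k) +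
    ((z *m pw k.+1 - wt z *: pw k.+1 -
      (k.+1%:R * wt (lie_bracket z y)) *: pw k) +
     (k.+1%:R * wt (lie_bracket z y)) *: pw k).
  rewrite subrK lie_bracket_mul !mulmxBr -!scalemxAr -!/(pw _.+1).
  rewrite -[k.+2%:R]natr1 mulrDl mul1r scalerDl opprD [RHS]addrC !addrA.
  rewrite -[pw k.+2]/(y *m pw k.+1) -[pw k.+1]/(y *m pw k).
  rewrite [LHS]addrAC; congr (_ - _).
  by rewrite [X in _ = X - _]addrAC subrK addrAC.
rewrite memvD ?krylov_mul ?IH // memvD ?memvZ ?mem_krylov //.
by apply: (subvP (krylovS _)); apply: IH.
Qed.

Lemma krylov_nilp k w x : x \in a -> w \in krylov k ->
  x *m w - wt x *: w \in krylov k.-1.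
Proof.
move=> xa; elim: k w => [|k IH] w /=; first by move=> wU; rewrite memvB ?memvZ ?aU.
case/memv_addP => t /IH tk [_ /vlineP[c ->] ->].
rewrite mulmxDr scalerDr opprD addrACA -scalemxAr scalerA mulrC -scalerA.
rewrite -scalerBr memvD ?memvZ //.
  by case: (k) tk => //= j; apply: (subvP (krylovS _)).
case: k {IH tk} => [|k]; first exact: wtP.
rewrite -(subrK ((k.+1%:R * wt (lie_bracket x y)) *: pw k) (_ - _)).
rewrite memvD ?memvZ ?mem_krylov //.
by apply: (subvP (krylovS _)); apply: krylov_weight.
Qed.

(* With k minimal such that y^k u lies in krylov k, comparing krylov_weight and
   krylov_nilp shows that k * wt [x, y] = 0. *)
Lemma weight_bracket x : x \in a -> wt (lie_bracket x y) = 0.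
Proof.
move=> xa.
have exk : exists k, pw k \in krylov k.
  have [/existsP[k]|/existsPn kU] := boolP [exists k : 'I_n.+1, pw k \in krylov k].
    by exists k.
  (* If no iterate fell into the preceding member of the chain, the chain would grow strictly up to
     dimension [n + 1]. *)
  suff dimk k : (k <= n.+1)%N -> (k <= \dim (krylov k))%N.
    have := leq_trans (dimk _ (leqnn _)) (dimvS (subvf _)).
    by rewrite dimvf /dim /= muln1 ltnn.
  elim: k => // k IH kn; apply: leq_ltn_trans (IH (ltnW kn)) _.
  rewrite (ltn_leqif (dimv_leqif_sup (krylovS k))); apply/negP => /subvP sk.
  by have := kU (Ordinal kn); rewrite /= sk ?mem_krylov.
case: (ex_minnP exk) => -[|k] pk kmin; first by rewrite /= (negPf uU) in pk.
have := memvB (krylov_nilp xa pk) (krylov_weight k xa).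
rewrite opprB addrC subrK.
have [/kmin|pkk] := boolP (pw k \in krylov k); first by rewrite ltnn.
have [//|wt0] := eqVneq (wt (lie_bracket x y)) 0.
move/(memvZ (k.+1%:R * wt (lie_bracket x y))^-1); rewrite scalerA mulVf.
  by rewrite scale1r (negPf pkk).
by rewrite mulf_neq0 ?pnatr_eq0.
Qed.

End Weight.

(** Induction on the dimension of [b]. A smaller ideal [a] with [b = a + <[y]>] has a weight vector;
    its weight space modulo [U] is stable under [y], because the weight vanishes on brackets with
    [y], and an eigenvector of [y] in it serves all of [b]. *)
Lemma lie_theorem b U W : lie_subalgebra b -> lie_solvable b ->
  (b <= transporter U U)%VS -> (b <= transporter W W)%VS -> ~~ (W <= U)%VS ->
  exists u, [/\ u \in W, u \notin U & (b <= transporter <[u]> (U + <[u]>))%VS].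
Proof.
have [m] := ubnP (\dim b); elim: m b => // m IH b /ltnSE dimb sb solb bU bW WU.
have act x V w : (b <= transporter V V)%VS -> x \in b -> w \in V -> x *m w \in V.
  by move=> /subvP bV /bV/transporterP; apply.
set b' := lie_prod b b; pose t := vbasis (b :\: b').
have bE : (b' + <<t>>)%VS = b.
  rewrite (span_basis (vbasisP _)) addvC; apply/eqP.
  by rewrite addv_diff eqEsubv subv_add subvv sb addvSl.
(* If the complement of the derived algebra is zero, [b] equals its derived algebra and so vanishes
   by solvability. *)
case def_t: (t : seq _) => [|y s].
  have b'E : b' = b by rewrite -bE def_t span_nil addv0.
  have b0 : b = 0%VS.
    by case: solb => k <-; elim: k => //= k <-.
  case/subvPn: WU => u uW uU; exists u; split=> //.
  by rewrite b0 sub0v.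
pose a := (b' + <<s>>)%VS.
have ab : (a + <[y]>)%VS = b by rewrite -bE def_t span_cons (addvC <[y]>%VS) addvA.
have yb : y \in b by rewrite -ab; apply: (subvP (addvSr _ _)); apply: memv_line.
have /subvP sab : (a <= b)%VS by rewrite -ab addvSl.
have ba x z : x \in b -> z \in b -> lie_bracket x z \in a.
  by move=> xb zb; apply: (subvP (addvSl _ _)); apply: mem_lie_prod.
have dima : (\dim a < m)%N.
  apply: leq_trans dimb; rewrite -(dimv_cap_compl b b') (capv_idPr _) //.
  rewrite -[X in (_ < _ + X)%N](size_tuple t) def_t /= addnS ltnS.
  by rewrite (leq_trans (dimv_add_leqif _ _)) ?leq_add2l ?dim_span.
have sa : lie_subalgebra a.
  by apply/lie_subalgebraP => x z /sab xb /sab; apply: ba.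
have [|||u [uW uU au]] := IH a dima sa _ _ _ WU.
- by apply: lie_solvableS solb; apply/subvP.
- by apply: subv_trans bU; apply/subvP.
- by apply: subv_trans bW; apply/subvP.
(* The functional [r] reads off the coefficient of [u] modulo [U], which is the weight. *)
have [r [rU ru]] := separating_row uU.
pose wt x := (r *m (x *m u)) 0 0.
have wtP x : x \in a -> x *m u - wt x *: u \in U.
  move=> /(subvP au)/transporterP/(_ u (memv_line u))/memv_addP.
  case=> w wU [_ /vlineP[c ->] xu].
  have -> : wt x = c.
    by rewrite /wt xu mulmxDr mxE rU // add0r -scalemxAr mxE ru mulr1.
  by rewrite xu addrK.
have wt0 x : x \in a -> wt (lie_bracket x y) = 0.
  apply: (weight_bracket _ _ _ uU wtP) => [z za|z w za|w]; last exact: act.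
  - by apply: ba => //; apply: sab.
  - by apply: act => //; apply: sab.
pose P w := w \in W /\ forall x, x \in a -> x *m w - wt x *: w \in U.
have Py w c : P w -> P (y *m w - c *: w).
  move=> [wW wP]; split=> [|x xa]; first by rewrite memvB ?memvZ ?act.
  have -> : x *m (y *m w - c *: w) - wt x *: (y *m w - c *: w) =
      y *m (x *m w - wt x *: w) + lie_bracket x y *m w -
      c *: (x *m w - wt x *: w).
    rewrite lie_bracket_mul !mulmxBr -!scalemxAr !scalerBr !scalerA (mulrC c).
    rewrite [X in _ = X - _]addrC [X in _ = X - _]addrA subrK !opprD !opprK.
    by rewrite [LHS]addrACA.
  apply: memvB; last exact/memvZ/wP.
  apply: memvD; first by apply: act => //; apply: wP.
  have := wP _ (ba x y (sab _ xa) yb).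
  by rewrite wt0 // scale0r subr0.
have [w [[wW wP] wU [c yw]]] := relative_eigenvector Py (conj uW wtP) uU.
exists w; split=> //; apply/subvP => x; rewrite -ab.
case/memv_addP=> z za [_ /vlineP[k ->] ->].
apply/transporterP => _ /vlineP[l ->]; rewrite -scalemxAr memvZ //.
have -> : (z + k *: y) *m w =
   (z *m w - wt z *: w + k *: (y *m w - c *: w)) + (wt z + k * c) *: w.
  by rewrite scalerBr scalerA scalerDl addrACA !subrK mulmxDl scalemxAl.
by rewrite memv_add ?memvZ ?memv_line // memvD ?memvZ ?wP.
Qed.

End LieTheorem.

(** * The quadratic space: orthogonal complements and bivectors *)

Section QuadraticSpace.
Variables (C : numClosedFieldType) (n : nat) (S : 'M[C]_n).
Hypotheses (symS : S^T = S) (unitS : S \in unitmx).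
Implicit Types (U W L : {vspace 'cV[C]_n}) (u w e f : 'cV[C]_n).
Implicit Types (x y g h p : 'M[C]_n) (b : {vspace 'M[C]_n}).

Definition gram u w : C := (u^T *m S *m w) 0 0.

Lemma gramC u w : gram u w = gram w u.
Proof.
rewrite /gram; have -> : u^T *m S *m w = (w^T *m S *m u)^T.
  by rewrite !trmx_mul trmxK symS mulmxA.
by rewrite mxE.
Qed.

Lemma gramDl u u' w : gram (u + u') w = gram u w + gram u' w.
Proof. by rewrite /gram linearD !mulmxDl mxE. Qed.
Lemma gramZl k u w : gram (k *: u) w = k * gram u w.
Proof. by rewrite /gram linearZ -!scalemxAl mxE. Qed.
Lemma gramDr u w w' : gram u (w + w') = gram u w + gram u w'.
Proof. by rewrite /gram mulmxDr mxE. Qed.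
Lemma gramZr k u w : gram u (k *: w) = k * gram u w.
Proof. by rewrite /gram -scalemxAr mxE. Qed.
Lemma gramNl u w : gram (- u) w = - gram u w.
Proof. by rewrite -scaleN1r gramZl mulN1r. Qed.
Lemma gramNr u w : gram u (- w) = - gram u w.
Proof. by rewrite -scaleN1r gramZr mulN1r. Qed.
Lemma gram0l w : gram 0 w = 0.
Proof. by rewrite -(scale0r 0) gramZl mul0r. Qed.
Lemma gram0r u : gram u 0 = 0.
Proof. by rewrite -(scale0r 0) gramZr mul0r. Qed.
Definition gramE :=
  (gramDl, gramDr, gramZl, gramZr, gramNl, gramNr, gram0l, gram0r).

Lemma gram_adj x y u w :
  x^T *m S = S *m y -> gram (x *m u) w = gram u (y *m w).
Proof.
by move=> xy; rewrite /gram trmx_mul -(mulmxA _ _ S) xy !mulmxA.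
Qed.

Lemma bilinear_ext (P Q : 'M[C]_n) :
  (forall u w, (u^T *m P *m w) 0 0 = (u^T *m Q *m w) 0 0) -> P = Q.
Proof.
move=> PQ; apply/matrixP => i j; have := PQ (delta_mx i 0) (delta_mx j 0).
by rewrite !trmx_delta -!rowE -!colE !mxE.
Qed.

Lemma soP x : reflect (forall u w, gram (x *m u) w = - gram u (x *m w))
                      (x \in so S).
Proof.
rewrite mem_so addr_eq0 -mulmxN; apply: (iffP eqP) => [xS u w|xS].
  by rewrite (gram_adj _ _ xS) mulNmx gramNr.
apply: bilinear_ext => u w; have := xS u w.
by rewrite -gramNr -mulNmx /gram trmx_mul !mulmxA.
Qed.

Lemma SOP g : g^T *m S *m g = S <->
  (forall u w, gram (g *m u) (g *m w) = gram u w).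
Proof.
split=> [gS u w|gS].
  by rewrite /gram trmx_mul -[in RHS]gS !mulmxA.
by apply: bilinear_ext => u w; rewrite -[RHS]gS /gram trmx_mul !mulmxA.
Qed.

Lemma gram_nondegenerate u : u != 0 -> exists w, gram u w = 1.
Proof.
case/cV0Pn => i ui; exists (invmx S *m ((u i 0)^-1 *: delta_mx i 0)).
rewrite /gram mulmxA -(mulmxA _ S) mulmxV // mulmx1 -scalemxAr -colE !mxE.
exact: mulVf.
Qed.

(** Encoded as the kernel of a matrix with [\dim U] rows, so that rank-nullity bounds its dimension
    from below. *)
Definition perp U : {vspace 'cV[C]_n} :=
  lker (linfun (mulmx (\matrix_(i < \dim U) (((vbasis U)`_i)^T *m S)) :
                'cV[C]_n -> 'cV[C]_(\dim U))).

Lemma perpP U w : reflect (forall u, u \in U -> gram u w = 0) (w \in perp U).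
Proof.
rewrite memv_ker lfunE /=.
have ME i : ((\matrix_(i < \dim U) (((vbasis U)`_i)^T *m S)) *m w) i 0 =
    gram (vbasis U)`_i w.
  rewrite /gram !mxE; apply: eq_bigr => j _; by rewrite !mxE.
apply: (iffP eqP) => [Mw u uU|Uw].
  rewrite (coord_vbasis uU); elim/big_ind: _ => [|s t su tu|i _].
  - by rewrite gramE.
  - by rewrite gramE su tu addr0.
  - by rewrite gramE -ME Mw mxE mulr0.
by apply/colP => i; rewrite ME mxE Uw // vbasis_mem // mem_nth // size_tuple.
Qed.

Lemma dim_perp U : (n <= \dim (perp U) + \dim U)%N.
Proof.
have := limg_ker_dim (linfun (mulmx (\matrix_(i < \dim U) (((vbasis U)`_i)^T *m S)) :
                'cV[C]_n -> 'cV[C]_(\dim U))) fullv.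
rewrite capfv -/(perp U) dimvf /dim /= muln1 => {1}<-; rewrite leq_add2l.
by rewrite (leq_trans (dimvS (subvf _))) // dimvf /dim /= muln1.
Qed.

Lemma perpS U W : (U <= W)%VS -> (perp W <= perp U)%VS.
Proof.
move=> /subvP UW; apply/subvP => w /perpP wW; apply/perpP => u /UW; exact: wW.
Qed.

Lemma mem_perp_line e w : (w \in perp <[e]>) = (gram e w == 0).
Proof.
apply/perpP/eqP => [->//|ew _ /vlineP[k ->]]; first exact: memv_line.
by rewrite gramE ew mulr0.
Qed.

Lemma perp_addv U W : perp (U + W) = (perp U :&: perp W)%VS.
Proof.
apply/eqP; rewrite eqEsubv subv_cap !perpS ?addvSl ?addvSr //=.
apply/subvP => w /memv_capP[/perpP wU /perpP wW]; apply/perpP => t.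
by case/memv_addP => u /wU uw [u' /wW uw' ->]; rewrite gramE uw uw' addr0.
Qed.

Lemma mem_perp_addv_line U e w :
  (w \in perp (U + <[e]>)) = (w \in perp U) && (gram e w == 0).
Proof. by rewrite perp_addv memv_cap (mem_perp_line e). Qed.

(** A vector outside [U] is separated from [U] by a functional, and nondegeneracy represents this
    functional by a vector of [perp U]. *)
Lemma perp_perp U : (perp (perp U) <= U)%VS.
Proof.
apply/subvP => u uUU; apply: contraT => /separating_row[a [aU au]].
have aE w : gram (invmx S *m a^T) w = (a *m w) 0 0.
  by rewrite /gram trmx_mul trmxK trmx_inv symS -(mulmxA a) mulVmx // mulmx1.
rewrite -(negPf (oner_neq0 C)) -au -aE; apply/eqP/(perpP _ _ uUU)/perpP => w wU.
by rewrite gramC aE aU.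
Qed.

Lemma perp_stable b U : (b <= so S)%VS ->
  (b <= transporter U U)%VS -> (b <= transporter (perp U) (perp U))%VS.
Proof.
move=> /subvP bS /subvP bU; apply/subvP => x xb; apply/transporterP => w /perpP wU.
apply/perpP => u uU; have /soP xS := bS x xb.
by apply/eqP; rewrite -oppr_eq0 -xS wU // (transporterP _ _ _ (bU x xb)).
Qed.

(** By dimension some [w] in [perp L] lies outside [L], so it pairs nontrivially with some [t] in
    [perp L]; then one of [w], [t], [t + w] is anisotropic. *)
Lemma perp_anisotropic L : (L <= perp L)%VS -> (\dim L * 2 < n)%N ->
  exists2 w, w \in perp L & gram w w != 0.
Proof.
move=> isoL dimL.
have /subvPn[w wL wnL] : ~~ (perp L <= L)%VS.
  apply/negP => /dimvS; rewrite leqNgt => /negP; apply.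
  have := dim_perp L; rewrite -(ltn_add2r (\dim L)) addnn -muln2.
  exact: leq_trans.
have [ww0|] := eqVneq (gram w w) 0; last by exists w.
have [t tL wt0] : exists2 t, t \in perp L & gram t w != 0.
  have /subvPn[t tL] : ~~ (perp L <= perp <[w]>)%VS.
    apply: contra wnL => /subvP Lw; apply/(subvP (perp_perp L))/perpP => t tL.
    by apply/eqP; rewrite gramC -mem_perp_line Lw.
  by rewrite mem_perp_line gramC; exists t.
have [tt0|] := eqVneq (gram t t) 0; last by exists t.
exists (t + w); rewrite ?memvD // !gramE tt0 ww0 addr0 add0r (gramC w t).
by rewrite -mulr2n mulrn_eq0.
Qed.

(** The bivector of [u] and [w] under the identification of [so S] with the exterior square of the
    space. *)
Definition wedge u w : 'M[C]_n := u *m (w^T *m S) - w *m (u^T *m S).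

Lemma wedgeE u w t : wedge u w *m t = gram w t *: u - gram u t *: w.
Proof.
have outer r s : r *m (s^T *m S) *m t = gram s t *: r.
  by rewrite -mulmxA [_ *m t]mx11_scalar mul_mx_scalar.
by rewrite mulmxBl !outer.
Qed.

Lemma wedge_so u w : wedge u w \in so S.
Proof.
apply/soP => s t; rewrite !wedgeE !gramE (gramC s u) (gramC s w) opprB.
by rewrite (mulrC (gram u t)) (mulrC (gram w t)).
Qed.

End QuadraticSpace.

(** * Isotropic flags stable under a Borel subalgebra *)

Section IsotropicFlags.
Variables (C : numClosedFieldType) (n : nat) (S : 'M[C]_n).
Hypotheses (symS : S^T = S) (unitS : S \in unitmx).
Implicit Types (U W L : {vspace 'cV[C]_n}) (u w e f : 'cV[C]_n).
Implicit Types (x y g h p : 'M[C]_n) (a b : {vspace 'M[C]_n}).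

Local Notation gram := (gram S).
Local Notation perp := (perp S).

Lemma so_gram_self x u : x \in so S -> gram u (x *m u) = 0.
Proof.
move/soP/(_ u u); rewrite (gramC symS) => /eqP.
by rewrite -addr_eq0 -mulr2n mulrn_eq0 => /eqP.
Qed.

(** Skewness gives [gram u (x *m u) = 0], so the eigenvalue on an anisotropic [u] is zero. *)
Lemma so_anisotropic_weight b U u : (b <= so S)%VS -> u \in perp U ->
  gram u u != 0 -> (b <= transporter <[u]> (U + <[u]>))%VS ->
  (b <= transporter <[u]> U)%VS.
Proof.
move=> /subvP bS /perpP uU uu /subvP bu; apply/subvP => x xb.
apply/transporterP => _ /vlineP[c ->]; rewrite -scalemxAr memvZ //.
have := so_gram_self u (bS x xb).
have := transporterP _ _ _ (bu x xb) u (memv_line u).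
case/memv_addP=> t tU [_ /vlineP[k ->] ->].
rewrite !gramE (gramC symS) uU // add0r => /eqP.
by rewrite mulf_eq0 (negPf uu) orbF => /eqP->; rewrite scale0r addr0.
Qed.

Lemma transporter_add b U W L :
  (b <= transporter U L)%VS -> (b <= transporter W L)%VS ->
  (b <= transporter (U + W) L)%VS.
Proof.
move=> /subvP bU /subvP bW; apply/subvP => x xb; apply/transporterP => t.
case/memv_addP => u uU [w wW ->]; rewrite mulmxDr memvD //.
  exact: (transporterP _ _ _ (bU x xb)).
exact: (transporterP _ _ _ (bW x xb)).
Qed.

Lemma transporter_addl b U W :
  (b <= transporter U U)%VS -> (b <= transporter W (U + W))%VS ->
  (b <= transporter (U + W) (U + W))%VS.
Proof.
move=> bU bW; apply: transporter_add => //; apply: subv_trans bU _.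
by apply: transporter_mono; rewrite ?addvSl.
Qed.

(* Weight vectors for nonzero weights are isotropic; two orthogonal
   anisotropic vectors of weight zero combine to an isotropic one. *)
Lemma isotropic_weight_vector b U : (b <= so S)%VS -> lie_subalgebra b ->
  lie_solvable b -> (b <= transporter U U)%VS ->
  (\dim U * 2 + 1 < n)%N ->
  exists e, [/\ e \in perp U, e \notin U, gram e e = 0 &
                (b <= transporter <[e]> (U + <[e]>))%VS].
Proof.
move=> bS sb solb bU dimU.
(* The two dimension bounds make [W] larger than [U], so Lie's theorem applies. *)
have lie W : (b <= transporter W W)%VS -> (n <= \dim W + \dim U + 1)%N ->
    exists u, [/\ u \in W, u \notin U & (b <= transporter <[u]> (U + <[u]>))%VS].
  move=> bW dimW; apply: lie_theorem => //.
  apply/negP => /dimvS WU; have := leq_trans dimU dimW.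
  by rewrite addn1 addn1 ltnS muln2 -addnn ltn_add2r ltnNge WU.
have [||u [uU uU' bu]] := lie (perp U); first exact: perp_stable.
  by rewrite (leq_trans (dim_perp S U)) ?leq_addr.
have [uu|uu] := eqVneq (gram u u) 0; first by exists u.
have bu0 := so_anisotropic_weight bS uU uu bu.
have [||w [wL wU bw]] := lie (perp (U + <[u]>)).
- by apply: perp_stable => //; apply: transporter_addl.
- rewrite -addnA (leq_trans (dim_perp S (U + <[u]>))) // leq_add2l.
  by rewrite (leq_trans (dimv_add_leqif _ _)) ?leq_add2l // dim_vline leq_b1.
move: wL; rewrite mem_perp_addv_line => /andP[wU' /eqP uw].
have [ww|ww] := eqVneq (gram w w) 0; first by exists w.
have bw0 := so_anisotropic_weight bS wU' ww bw.
(* This square root makes the norms cancel in [k *: u + w]; both vectors have weight zero, so the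
   sum is still a weight vector. *)
pose k := sqrtC (- gram w w / gram u u).
have kk : k * k * gram u u = - gram w w by rewrite -expr2 sqrtCK divfK.
have k0 : k != 0 by rewrite sqrtC_eq0 mulf_neq0 ?invr_eq0 ?oppr_eq0.
exists (k *: u + w); split.
- by rewrite memvD ?memvZ.
- apply: contra uu => /(perpP _ _ _ uU); rewrite !gramE (gramC symS w) uw addr0.
  by move/eqP; rewrite mulf_eq0 (negPf k0).
- by rewrite !gramE (gramC symS w) uw addr0 mulr0 add0r mulrA kk addNr.
apply/subvP => x xb; apply/transporterP => _ /vlineP[c ->].
apply: (subvP (addvSl _ _)); rewrite -scalemxAr memvZ // mulmxDr -scalemxAr.
apply: memvD; first apply: memvZ.
  exact: (transporterP _ _ _ (subvP bu0 x xb) u (memv_line u)).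
exact: (transporterP _ _ _ (subvP bw0 x xb) w (memv_line w)).
Qed.

Lemma so_bracket x y : x \in so S -> y \in so S -> lie_bracket x y \in so S.
Proof.
move=> /soP xS /soP yS; apply/soP => u w; rewrite !lie_bracket_mul !gramE.
by rewrite !(xS, yS) !opprK opprB.
Qed.

Section Radical.
Variables (U : {vspace 'cV[C]_n}) (e : 'cV[C]_n).
Let L := (U + <[e]>)%VS.

(* The solvable radical of the stabilizer of the flag U <= L, cut down to the
   elements that vanish on U. *)
Definition flag_radical : {vspace 'M[C]_n} :=
  (so S :&: transporter U 0 :&: transporter L L :&: transporter (perp L) L)%VS.

Hypotheses (isoU : (U <= perp U)%VS) (eU : e \in perp U) (ee : gram e e = 0).

Lemma flag_isotropic : (L <= perp L)%VS.
Proof.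
rewrite perp_addv subv_cap !subv_add isoU -!memvE eU mem_perp_line ee eqxx /= andbT.
apply/subvP => u uU; rewrite mem_perp_line (gramC symS).
by rewrite (perpP _ _ _ eU).
Qed.

Lemma flag_radicalP x : x \in flag_radical <->
  [/\ x \in so S, forall u, u \in U -> x *m u = 0,
      forall w, w \in L -> x *m w \in L & forall w, w \in perp L -> x *m w \in L].
Proof.
split.
  case/memv_capP => /memv_capP[/memv_capP[xS /transporterP xU]].
  move=> /transporterP xL /transporterP xL'; split=> // u /xU.
  by rewrite memv0 => /eqP.
case=> xS xU xL xL'; rewrite !memv_cap xS /= -andbA; apply/and3P.
by split; apply/transporterP => // u uU; rewrite memv0 xU.
Qed.

Lemma flag_radical_ideal a : (a <= so S)%VS -> (a <= transporter U U)%VS ->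
  (a <= transporter L L)%VS -> (lie_prod a flag_radical <= flag_radical)%VS.
Proof.
move=> aS aU aL; have /subvP aL' := perp_stable aS aL.
move: aS aU aL => /subvP aS /subvP aU /subvP aL.
apply/lie_prod_subP => x y xa /flag_radicalP[yS yU yL yL'].
have /transporterP xU := aU x xa; have /transporterP xL := aL x xa.
have /transporterP xL' := aL' x xa.
apply/flag_radicalP; split=> [|u uU|w wL|w wL'].
- by apply: so_bracket => //; apply: aS.
- by rewrite lie_bracket_mul yU // yU ?xU // mulmx0 subr0.
- by rewrite lie_bracket_mul memvB ?xL ?yL ?xL.
- by rewrite lie_bracket_mul memvB ?yL' ?xL' ?xL ?yL'.
Qed.

Lemma flag_radical_sub : [/\ (flag_radical <= so S)%VS,
  (flag_radical <= transporter U U)%VS & (flag_radical <= transporter L L)%VS].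
Proof.
split; apply/subvP => x /flag_radicalP[xS xU xL _] //.
  by apply/transporterP => u /xU->; apply: mem0v.
by apply/transporterP.
Qed.

Lemma flag_radical_subalgebra : lie_subalgebra flag_radical.
Proof. by case: flag_radical_sub => ???; apply: flag_radical_ideal. Qed.

(** The derived algebra is strictly triangular on the flag formed by 0, [U], [L], [perp L], [perp U]
    and the whole space: scalars on [L] modulo [U] disappear in brackets, and the upper two steps
    are dual to the lower two. *)
Lemma flag_radical_solvable : lie_solvable flag_radical.
Proof.
case: flag_radical_sub => NS NU NL; apply: lie_solvable_derived.
(* The default value of [nth] supplies the whole space from index 5 on. *)
pose fl := nth fullv [:: 0%VS; U; L; perp L; perp U].
apply: (@lie_solvable_flag _ _ fl 5) => //.
  move=> [|[|[|[|[|i]]]]]; rewrite /fl /= ?nth_nil ?sub0v ?subvf ?addvSl //.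
    exact: flag_isotropic.
  by apply: perpS; apply: addvSl.
have NLU : (lie_prod flag_radical flag_radical <= transporter L U)%VS.
  apply: lie_prod_transporter_line => //; apply: subv_trans NL _.
  by apply: transporter_mono; rewrite ?addvSr.
move=> i; apply/subvP => x xN; apply/transporterP => w.
have /flag_radicalP[/soP xS xU xL xL'] := subvP flag_radical_subalgebra x xN.
have /transporterP xLU := subvP NLU x xN.
case: i => [|[|[|[|[|i]]]]]; rewrite /fl /= ?nth_nil ?memvf //.
- by move/xU->; apply: mem0v.
- exact: xLU.
- exact: xL'.
- move/perpP => wU; apply/perpP => u uL.
  by apply/eqP; rewrite -oppr_eq0 -xS wU // xLU.
- move=> _; apply/perpP => u uU.
  by apply/eqP; rewrite -oppr_eq0 -xS xU // gramE.
Qed.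

Lemma wedge_flag_radical w : w \in perp L -> wedge S e w \in flag_radical.
Proof.
move=> /perpP wL; apply/flag_radicalP.
have eL : e \in L by apply: (subvP (addvSr _ _)); apply: memv_line.
split=> [|u uU|u uL|u /perpP uL]; rewrite ?wedge_so // wedgeE.
- rewrite (gramC symS w) wL ?(gramC symS e) ?(perpP _ _ _ eU) //.
    by rewrite !scale0r subrr.
  exact: (subvP (addvSl _ _)).
- rewrite (gramC symS w) wL // (perpP _ _ _ (subvP flag_isotropic u uL)) //.
  by rewrite !scale0r subrr mem0v.
- by rewrite (uL e) // scale0r subr0 memvZ.
Qed.

Section Borel.
Variable b : {vspace 'M[C]_n}.
Hypothesis borelb : borel_subalgebra (so S) b.
Hypotheses (bU : (b <= transporter U U)%VS).
Hypotheses (be : (b <= transporter <[e]> L)%VS).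

(** The radical is a solvable subalgebra normalized by [b]. *)
Lemma flag_radical_borel : (flag_radical <= b)%VS.
Proof.
case: flag_radical_sub => NS _ _; case: (borelb) => bS _ _ _.
apply: borel_normalized borelb NS _ flag_radical_subalgebra flag_radical_solvable.
by apply: flag_radical_ideal => //; apply: transporter_addl.
Qed.

Hypotheses (eU' : e \notin U) (dimL : (\dim L * 2 < n)%N).

(** The operators [wedge S e w] with [w] in [perp L] lie in [b], so each maps [u] into [U + <[u]>].
    An anisotropic [w] yields [gram e u = 0]; then each [w] either is orthogonal to [u] or places
    [u] in [L] at once, and the double complement of [L] lies in [L]. *)
Lemma weight_vector_unique u : u \in perp U ->
  (b <= transporter <[u]> (U + <[u]>))%VS -> u \in L.
Proof.
move=> /perpP uU /subvP bu.
have eL : e \in L by apply: (subvP (addvSr _ _)); apply: memv_line.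
have UL : {subset U <= L} by apply/subvP/addvSl.
have act w : w \in perp L -> exists k, exists2 t, t \in U &
    gram w u *: e - gram e u *: w = t + k *: u.
  move=> /wedge_flag_radical/(subvP flag_radical_borel)/bu/transporterP.
  move/(_ u (memv_line u)); rewrite wedgeE => /memv_addP[t tU [_ /vlineP[k ->]]].
  by exists k, t.
have eu : gram e u = 0.
  have [w wL ww] := perp_anisotropic symS unitS flag_isotropic dimL.
  have [k [t tU E]] := act w wL; move/perpP in wL.
  have we : gram w e = 0 by rewrite (gramC symS) wL.
  have wt : gram w t = 0 by rewrite (gramC symS) wL ?UL.
  have et : gram e t = 0 by rewrite (gramC symS) (perpP _ _ _ eU).
  have := congr1 (gram e) E; have := congr1 (gram w) E.
  rewrite !gramE ee we wt et (wL e) // !mulr0 !subr0 !add0r.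
  have [->|k0] := eqVneq k 0.
    by rewrite mul0r => /eqP; rewrite oppr_eq0 mulf_eq0 (negPf ww) orbF => /eqP.
  by move=> _ /esym/eqP; rewrite mulf_eq0 (negPf k0) => /eqP.
apply: contraT => uL; case/negP: (uL).
apply: (subvP (perp_perp symS unitS L)); apply/perpP => w wL.
have [k [t tU]] := act w wL; rewrite eu scale0r subr0 (gramC symS) => E.
have [k0|k0] := eqVneq k 0.
  have [//|wu0] := eqVneq (gram u w) 0; case/negP: eU'.
  by rewrite -(scalerK wu0 e) memvZ // E k0 scale0r addr0.
case/negP: uL; rewrite -(scalerK k0 u) memvZ //.
have -> : k *: u = gram u w *: e - t by rewrite E addrC addKr.
by apply: memvB; [apply: memvZ | apply: UL].
Qed.
End Borel.

End Radical.

End IsotropicFlags.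

(** * Conjugation by the special orthogonal group *)

Section AdjointAction.
Variables (C : numClosedFieldType) (n : nat) (S : 'M[C]_n).
Implicit Types (g h p x y : 'M[C]_n) (b V W : {vspace 'M[C]_n}).

Lemma SO_group_unit g : SO_group S g -> g \in unitmx.
Proof. by case=> _ g1; rewrite unitmxE g1 unitr1. Qed.

Lemma orthogonal_mul g h : g^T *m S *m g = S -> h^T *m S *m h = S ->
  (g *m h)^T *m S *m (g *m h) = S.
Proof.
by move=> gS hS; rewrite trmx_mul -!mulmxA (mulmxA g^T) (mulmxA _ g) gS mulmxA.
Qed.

Lemma SO_group_mul g h : SO_group S g -> SO_group S h -> SO_group S (g *m h).
Proof.
move=> [gS g1] [hS h1]; split; first exact: orthogonal_mul.
by rewrite det_mulmx g1 h1 mulr1.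
Qed.

Lemma SO_group_inv g : SO_group S g -> SO_group S (invmx g).
Proof.
move=> SOg; have ug := SO_group_unit SOg; case: SOg => gS g1.
split; last by rewrite det_inv g1 invr1.
by rewrite -{1}gS -!mulmxA mulmxV // mulmx1 mulmxA -trmx_mul mulmxV // trmx1 mul1mx.
Qed.

Lemma adjointE g V x : g \in unitmx ->
  (x \in adjoint_act g V) = (invmx g *m x *m g \in V).
Proof.
move=> ug; apply/memv_imgP/idP => [[y yV ->]|xV].
  by rewrite lfunE /= !mulmxA mulVmx // mul1mx mulmxKV.
exists (invmx g *m x *m g) => //; rewrite lfunE /= !mulmxA.
by rewrite mulmxV // mul1mx mulmxK.
Qed.

Lemma adjointM g h V : g \in unitmx -> h \in unitmx ->
  adjoint_act (g *m h) V = adjoint_act g (adjoint_act h V).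
Proof.
move=> ug uh; apply/vspaceP => x; rewrite !adjointE ?unitmx_mul ?ug //.
have -> : invmx (g *m h) = invmx h *m invmx g.
  rewrite -[RHS](mulKmx (_ : g *m h \in unitmx)) ?unitmx_mul ?ug //.
  by rewrite -mulmxA mulKVmx // mulmxV // mulmx1.
by rewrite !mulmxA.
Qed.

Lemma adjointK g V : g \in unitmx -> adjoint_act (invmx g) (adjoint_act g V) = V.
Proof.
move=> ug; apply/vspaceP => x; rewrite !adjointE ?unitmx_inv // invmxK !mulmxA.
by rewrite mulVmx // mul1mx mulmxKV.
Qed.

Lemma adjointKV g V : g \in unitmx -> adjoint_act g (adjoint_act (invmx g) V) = V.
Proof. by move=> ug; rewrite -{1}[g]invmxK adjointK ?unitmx_inv. Qed.

Lemma adjointS g V W : (V <= W)%VS -> (adjoint_act g V <= adjoint_act g W)%VS.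
Proof. exact: limgS. Qed.

Lemma dim_adjoint g V : g \in unitmx -> \dim (adjoint_act g V) = \dim V.
Proof.
have le h W : (\dim (adjoint_act h W) <= \dim W)%N.
  rewrite /adjoint_act; set f := linfun _.
  by rewrite -[X in (_ <= X)%N](limg_ker_dim f) leq_addl.
move=> ug; apply/eqP; rewrite eqn_leq le /=.
by rewrite -{1}(adjointK V ug) le.
Qed.

Lemma so_adjoint g : SO_group S g -> adjoint_act g (so S) = so S.
Proof.
have sub h : SO_group S h -> (adjoint_act h (so S) <= so S)%VS.
  move=> SOh; have uh := SO_group_unit SOh.
  have /SOP hg : h^T *m S *m h = S by case: SOh.
  apply/subvP => x; rewrite adjointE // => /soP xS; apply/soP => u w.
  rewrite -[u](mulKVmx uh) -[w](mulKVmx uh) -[x]mul1mx -(mulmxV uh) !mulmxA.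
  have xE t : h *m invmx h *m x *m h *m t = h *m (invmx h *m x *m h *m t).
    by rewrite !mulmxA.
  by rewrite -!(mulmxA _ (invmx h) (_ : 'cV_n)) !xE !hg xS.
move=> SOg; apply/eqP; rewrite eqEsubv sub //.
rewrite -{1}(adjointKV (so S) (SO_group_unit SOg)); apply: adjointS.
exact/sub/SO_group_inv.
Qed.

Lemma lie_prod_adjoint g V W : g \in unitmx ->
  (lie_prod (adjoint_act g V) (adjoint_act g W) <= adjoint_act g (lie_prod V W))%VS.
Proof.
move=> ug; apply/lie_prod_subP => x y; rewrite !adjointE // => xV yW.
have -> : invmx g *m lie_bracket x y *m g =
    lie_bracket (invmx g *m x *m g) (invmx g *m y *m g).
  rewrite /lie_bracket mulmxBr mulmxBl.
  by congr (_ - _); rewrite !mulmxA mulmxK.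
exact: mem_lie_prod.
Qed.

Lemma borel_adjoint g b : SO_group S g ->
  borel_subalgebra (so S) b -> borel_subalgebra (so S) (adjoint_act g b).
Proof.
have alg h V : h \in unitmx -> lie_subalgebra V -> lie_subalgebra (adjoint_act h V).
  by move=> uh sV; apply: subv_trans (lie_prod_adjoint _ _ uh) (adjointS _ sV).
have sol h V : h \in unitmx -> lie_solvable V -> lie_solvable (adjoint_act h V).
  move=> uh [k Vk]; exists k; apply/eqP; rewrite -subv0.
  have <- : adjoint_act h 0 = 0%VS by rewrite /adjoint_act limg0.
  rewrite -Vk; elim: k {Vk} => //= k IH.
  by apply: subv_trans (lie_prod_adjoint _ _ uh); apply: lie_prodS.
move=> SOg [bS sb solb bmax]; have ug := SO_group_unit SOg.
have ug' : invmx g \in unitmx by rewrite unitmx_inv.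
split; [by rewrite -(so_adjoint SOg) adjointS | exact: alg | exact: sol |].
move=> b' b'S sb' solb' bb'; rewrite -(adjointKV b' ug); congr adjoint_act.
apply: bmax; [|exact: alg|exact: sol|].
  by rewrite -(so_adjoint (SO_group_inv SOg)) adjointS.
by rewrite -{1}(adjointK b ug) adjointS.
Qed.

End AdjointAction.

(** * Group elements stabilizing a Borel subalgebra and its flag *)

Section FlagStabilizer.
Variables (C : numClosedFieldType) (n : nat) (S : 'M[C]_n).
Hypotheses (symS : S^T = S) (unitS : S \in unitmx).
Variables (b : {vspace 'M[C]_n}) (U : {vspace 'cV[C]_n}) (e : 'cV[C]_n).
Let L := (U + <[e]>)%VS.
Local Notation gram := (gram S).
Local Notation perp := (perp S).
Hypotheses (isoU : (U <= perp U)%VS) (eU : e \in perp U) (ee : gram e e = 0).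
Hypothesis borelb : borel_subalgebra (so S) b.
Hypotheses (bU : (b <= transporter U U)%VS).
Hypotheses (be : (b <= transporter <[e]> L)%VS).

(** The image [p *m e] is again a weight vector for [b] modulo [U], orthogonal to [U], and
    uniqueness of such vectors places it in [L]. *)
Lemma flag_stable p : e \notin U -> (\dim L * 2 < n)%N ->
  SO_group S p -> adjoint_act p b = b ->
  (forall u, u \in U -> p *m u \in U) ->
  (forall u, u \in U -> invmx p *m u \in U) ->
  forall w, w \in L -> p *m w \in L.
Proof.
move=> eU' dimL SOp pb pU p'U w.
have up := SO_group_unit SOp; have /SOP gp : p^T *m S *m p = S by case: SOp.
case/memv_addP => u uU [_ /vlineP[c ->] ->]; rewrite mulmxDr -scalemxAr memvD //.
  by apply: (subvP (addvSl _ _)); apply: pU.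
apply/memvZ/(weight_vector_unique symS unitS isoU eU ee borelb bU be) => //.
  by apply/perpP => t tU; rewrite -(mulKVmx up t) gp (perpP _ _ _ eU) // p'U.
apply/subvP => x; rewrite -{1}pb adjointE // => xb.
apply/transporterP => _ /vlineP[k ->]; rewrite -scalemxAr memvZ //.
have := transporterP _ _ _ (subvP be _ xb) e (memv_line e).
case/memv_addP => t tU [_ /vlineP[l ->] E].
have -> : x *m (p *m e) = p *m (t + l *: e) by rewrite -E !mulmxA mulmxV // mul1mx.
by rewrite mulmxDr -scalemxAr memv_add ?pU ?memvZ ?memv_line.
Qed.

(** Conjugation changes an element of [b] by an element of [flag_radical], which lies in [b]. The
    conditions concern both [h] and its inverse [h'] because a conjugate involves both. *)
Lemma flag_radical_group_adjoint h h' :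
  (forall g, g = h \/ g = h' ->
    [/\ SO_group S g, forall u, u \in U -> g *m u = u,
      forall w, w \in L -> g *m w \in L &
      forall w, w \in perp L -> g *m w - w \in L]) ->
  h *m h' = 1%:M -> adjoint_act h b = b.
Proof.
move=> hyp hh'; have h'h := mulmx1C hh'.
have [bS _ _ _] := borelb.
have bL : (b <= transporter L L)%VS by apply: transporter_addl.
have /subvP bL' := perp_stable bS bL.
have isoL := flag_isotropic symS isoU eU ee.
have sub g g' x : g = h \/ g = h' -> g' = h \/ g' = h' -> g *m g' = 1%:M ->
    x \in b -> g *m x *m g' \in b.
  move=> /hyp[SOg gU gL gL'] /hyp[SOg' g'U g'L g'L'] gg' xb.
  have ug := SO_group_unit SOg.
  have g'E : g' = invmx g by rewrite -[g'](mulKmx ug) gg' mulmx1.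
  have xL : forall w, w \in L -> x *m w \in L.
    by apply/transporterP; apply: (subvP bL).
  have xU : forall u, u \in U -> x *m u \in U.
    by apply/transporterP; apply: (subvP bU).
  rewrite -(subrK x (g *m x *m g')) memvD //.
  apply: (subvP (flag_radical_borel symS isoU eU ee borelb bU be)).
  apply/flag_radicalP; split=> [|u uU|w wL|w wL]; rewrite ?mulmxBl -?mulmxA.
  - apply: memvB; last exact: (subvP bS).
    rewrite -(so_adjoint SOg) adjointE // g'E !mulmxA.
    by rewrite mulVmx // mul1mx mulmxKV // (subvP bS).
  - by rewrite g'U // gU ?xU // subrr.
  - by rewrite memvB ?xL ?gL // xL // g'L.
  have [t tL ->] : exists2 t, t \in L & g' *m w = w + t.
    by exists (g' *m w - w); rewrite ?g'L' // addrC subrK.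
  rewrite !mulmxDr addrAC memvD //; last by rewrite gL // xL.
  by apply: gL'; move: (bL' x xb) => /transporterP; apply.
have [SOh _ _ _] := hyp h (or_introl erefl); have uh := SO_group_unit SOh.
have h'E : h' = invmx h by rewrite -[h'](mulKmx uh) hh' mulmx1.
apply/vspaceP => x; rewrite adjointE // -h'E; apply/idP/idP => [xb|]; last first.
  by apply: sub; auto.
have := sub h h' _ (or_introl erefl) (or_intror erefl) hh' xb.
by rewrite !mulmxA hh' mul1mx -mulmxA hh' mulmx1.
Qed.

End FlagStabilizer.

(** * Zariski closed sets along a polynomial curve of conjugates *)

Section Zariski.
Variables (C : numClosedFieldType) (n : nat).

Lemma meval_dhomog m (f : {mpoly C[m]}) d k (t : 'I_m -> C) :
  f \is d.-homog -> f.@[fun i => k * t i] = k ^+ d * f.@[t].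
Proof.
move=> /dhomogP fd; rewrite !mevalE mulr_sumr; apply: eq_big_seq => s sf.
rewrite mulrCA; congr (_ * _); have -> : d = mdeg s by rewrite -(fd s sf).
rewrite mdegE -prodrXr -big_split /=.
by apply: eq_bigr => i _; rewrite exprMn.
Qed.

Lemma meval_horner m (f : {mpoly C[m]}) (p : 'I_m -> {poly C}) :
  exists q : {poly C}, forall s, q.[s] = f.@[fun i => (p i).[s]].
Proof.
exists (\sum_(k <- msupp f) (f@_k)%:P * \prod_i p i ^+ k i) => s.
rewrite mevalE horner_sum; apply: eq_bigr => k _.
rewrite hornerM hornerC horner_prod; congr (_ * _).
by apply: eq_bigr => i _; rewrite horner_exp.
Qed.

(** In characteristic zero the shifts of [s0] by positive integers give more roots than the degree
    allows. *)
Lemma poly_eq0_cofinite (q : {poly C}) s0 :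
  (forall s, s != s0 -> q.[s] = 0) -> q = 0.
Proof.
move=> q0; apply: contraTeq isT => nzq.
pose rs := [seq s0 + i.+1%:R | i <- iota 0 (size q)].
have := max_poly_roots nzq (_ : all (root q) rs) (_ : uniq rs).
rewrite size_map size_iota ltnn; apply.
  apply/allP => _ /mapP[i _ ->]; apply/eqP/q0.
  by rewrite -subr_eq0 addrC addKr pnatr_eq0.
rewrite map_inj_uniq ?iota_uniq // => i j /addrI/eqP.
by rewrite eqr_nat eqSS => /eqP.
Qed.

(** A change of frame multiplies all Plucker coordinates by one common factor. *)
Lemma det_colsub_mul d m (f : 'I_d -> 'I_m) (A B : 'M[C]_(d, m)) (M : 'M[C]_d) :
  A = M *m B -> \det (colsub f A) = \det M * \det (colsub f B).
Proof.
move=> ->; rewrite -det_mulmx; congr determinant.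
by apply/matrixP => i j; rewrite !mxE; apply: eq_bigr => k _; rewrite !mxE.
Qed.

Definition evmx m k s (M : 'M[{poly C}]_(m, k)) : 'M[C]_(m, k) :=
  map_mx (horner_eval s) M.

Lemma evmxM m k l s (M : 'M[{poly C}]_(m, k)) (N : 'M[{poly C}]_(k, l)) :
  evmx s (M *m N) = evmx s M *m evmx s N.
Proof. exact: map_mxM. Qed.

Lemma evmxC m k s (M : 'M[C]_(m, k)) : evmx s (map_mx polyC M) = M.
Proof. by apply/matrixP => i j; rewrite !mxE /horner_eval hornerC. Qed.

Lemma mul_rows_mxvec d m (A : 'I_d -> 'M[C]_n) (B : 'I_m -> 'M[C]_n)
    (M : 'M_(d, m)) :
  (forall i, A i = \sum_j M i j *: B j) ->
  \matrix_(i < d) mxvec (A i) = M *m \matrix_(i < m) mxvec (B i).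
Proof.
move=> AB; apply/row_matrixP => i; rewrite row_mul mulmx_sum_row rowK AB.
by rewrite linear_sum; apply: eq_bigr => j _; rewrite linearZ mxE rowK.
Qed.

Lemma frame_span d (V : {vspace 'M[C]_n}) (A : 'I_d -> 'M[C]_n) :
  \dim V = d -> (forall i, A i \in V) ->
  exists M : 'M_d, \matrix_(i < d) mxvec (A i) = M *m frame d V.
Proof.
move=> dV; case: d / dV A => A AV.
exists (\matrix_(i, j) coord (vbasis V) j (A i)); apply: mul_rows_mxvec => i.
by rewrite {1}(coord_vbasis (AV i)); apply: eq_bigr => j _; rewrite mxE.
Qed.

(** A basis of [b] conjugated by [P] has polynomial entries, because the inverse of [P] is the
    polynomial matrix [Q]. Each homogeneous equation of [Z] becomes a polynomial in [s], and one
    that vanishes off [s0] vanishes at [s0]. *)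
Lemma zariski_closed_line (X Z : {vspace 'M[C]_n} -> Prop) b
    (P Q : 'M[{poly C}]_n) s0 :
  zariski_closed_in X Z ->
  (forall s, evmx s P *m evmx s Q = 1%:M) ->
  (forall s, X (adjoint_act (evmx s P) b)) ->
  (forall s, s != s0 -> Z (adjoint_act (evmx s P) b)) ->
  Z (adjoint_act (evmx s0 P) b).
Proof.
move=> [I [Ihom IP]] PQ XP ZP.
pose d : nat := \dim b.
have uP s : evmx s P \in unitmx by case: (mulmx1_unit (PQ s)).
have QE s : invmx (evmx s P) = evmx s Q.
  by rewrite -[RHS](mulKmx (uP s)) PQ mulmx1.
(* The equations are indexed by dimension; every conjugate of [b] uses those of the fixed dimension
   [d]. *)
have IPd V : X V -> \dim V = d ->
    (Z V <-> forall f, I d f -> f.@[plucker (d := d) V] = 0).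
  by move=> XV <-; apply: IP.
pose G : 'M[{poly C}]_(d, n * n) :=
  \matrix_(i < d) mxvec (P *m map_mx polyC (vbasis b)`_i *m Q).
pose cols (k : 'I_(plucker_index n d)) : {ffun 'I_d -> 'I_(n * n)} := enum_val k.
pose co s k := \det (colsub (cols k) (evmx s G)).
have evG s : evmx s G =
    \matrix_(i < d) mxvec (evmx s P *m (vbasis b)`_i *m invmx (evmx s P)).
  rewrite QE; apply/row_matrixP => i; rewrite -map_row !rowK.
  by rewrite /evmx map_mxvec -!/(evmx s _) !evmxM evmxC.
(* The polynomial frame and the chosen basis of the conjugate generate each other; a factor in each
   direction is enough for homogeneous equations to vanish on both or on neither. *)
have comb s : exists M M' : 'M[C]_d,
    evmx s G = M *m frame d (adjoint_act (evmx s P) b) /\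
    frame d (adjoint_act (evmx s P) b) = M' *m evmx s G.
  set V := adjoint_act _ _; have dimV : \dim V = d by apply: dim_adjoint.
  rewrite evG; set p := evmx s P; have up : p \in unitmx := uP s.
  have AV (i : 'I_d) : p *m (vbasis b)`_i *m invmx p \in V.
    rewrite adjointE // !mulmxA mulVmx // mul1mx mulmxKV //.
    by rewrite vbasis_mem // mem_nth // size_tuple; exact: (ltn_ord i).
  have [M ME] := frame_span dimV AV.
  exists M, (\matrix_(i, j) coord (vbasis b) j (invmx p *m (vbasis V)`_i *m p)).
  split=> //; apply: mul_rows_mxvec => i.
  have vV : (vbasis V)`_i \in V.
    by rewrite vbasis_mem // mem_nth // size_tuple dimV; exact: (ltn_ord i).
  have {}vV : invmx p *m (vbasis V)`_i *m p \in b by rewrite -adjointE.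
  have -> : (vbasis V)`_i = p *m (invmx p *m (vbasis V)`_i *m p) *m invmx p.
    by rewrite !mulmxA mulmxV // mul1mx mulmxK.
  rewrite {1}(coord_vbasis vV) mulmx_sumr mulmx_suml; apply: eq_bigr => j _.
  by rewrite mxE -scalemxAr -scalemxAl.
have coE s : exists k k', forall i,
   co s i = k * plucker (d := d) (adjoint_act (evmx s P) b) i /\
   plucker (d := d) (adjoint_act (evmx s P) b) i = k' * co s i.
  have [M [M' [E E']]] := comb s; exists (\det M), (\det M') => i.
  by split; apply: det_colsub_mul.
apply/IPd => //; first exact: dim_adjoint.
move=> f If; have [e fe] := Ihom d f If.
have fco s : (f.@[co s] = 0) <-> f.@[plucker (d := d) (adjoint_act (evmx s P) b)] = 0.
  have [k [k' E]] := coE s; split => f0.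
    rewrite (meval_eq (v2 := fun i => k' * co s i)); last by move=> i; case: (E i).
    by rewrite (meval_dhomog _ _ fe) f0 mulr0.
  rewrite (meval_eq (v2 := fun i => k * plucker (d := d) (adjoint_act (evmx s P) b) i)).
    by rewrite (meval_dhomog _ _ fe) f0 mulr0.
  by move=> i; case: (E i).
apply/fco.
have [q qE] := meval_horner f (fun k => \det (colsub (cols k) G)).
have qco s : q.[s] = f.@[co s].
  rewrite qE; apply: meval_eq => k; rewrite /co -[LHS]/(horner_eval s _).
  by rewrite -det_map_mx map_mxsub.
rewrite -qco (@poly_eq0_cofinite q s0) ?horner0 // => s ss0.
rewrite qco; apply/fco; move: f If {fe fco qE qco}.
by apply/IPd; [apply: XP | apply: dim_adjoint | apply: ZP].
Qed.

End Zariski.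

(** * One-parameter unipotent groups *)

Section Unipotent.
Variables (C : numClosedFieldType) (n : nat) (S A : 'M[C]_n).

(** The exponential of [s *: A], whose series stops here when the cube of [A] is zero. *)
Definition quad_exp s : 'M[C]_n := 1%:M + s *: A + (s ^+ 2 / 2) *: (A *m A).

(** The values -1 and 1 of [k] give a polynomial curve and its inverse. *)
Definition quad_exp_poly k : 'M[{poly C}]_n :=
  1%:M + (k%:P * 'X) *: map_mx polyC A +
  ((k ^+ 2 / 2)%:P * 'X^2) *: map_mx polyC (A *m A).

Lemma evmx_quad_exp k s : evmx s (quad_exp_poly k) = quad_exp (k * s).
Proof.
apply/matrixP => i j; rewrite /evmx !mxE /horner_eval !hornerE.
rewrite hornerMn -polyC1 hornerC /= exprMn; congr (_ + _ * _).
by rewrite -mulrA -expr2 mulrAC.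
Qed.

(** The determinant of an orthogonal matrix squares to 1. *)
Lemma orthogonal_sqr_SO g : S \in unitmx -> g^T *m S *m g = S ->
  SO_group S (g *m g).
Proof.
move=> uS gS; split; first exact: orthogonal_mul.
have := congr1 determinant gS; rewrite !det_mulmx det_tr mulrAC.
by rewrite -[RHS]mul1r => /mulIf; apply; rewrite -unitfE -unitmxE.
Qed.

Hypothesis A3 : A *m A *m A = 0.

Lemma quad_expD s t : quad_exp s *m quad_exp t = quad_exp (s + t).
Proof.
have A3' : A *m (A *m A) = 0 by rewrite mulmxA.
have A4 : A *m A *m (A *m A) = 0 by rewrite mulmxA A3 mul0mx.
rewrite /quad_exp !mulmxDl !mulmxDr -!scalemxAl -!scalemxAr !mul1mx !mulmx1.
rewrite A3 A3' A4 !scaler0 !addr0 addrC (addrC s).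
have -> : (t + s) ^+ 2 / 2 = t ^+ 2 / 2 + s * t + s ^+ 2 / 2 by field.
by rewrite addrC !scalerDl scalerA !addrA; congr (_ + _ + _); exact: addrAC.
Qed.

Lemma quad_exp0 : quad_exp 0 = 1%:M.
Proof. by rewrite /quad_exp expr0n mul0r !scale0r !addr0. Qed.

Hypotheses (unitS : S \in unitmx) (Aso : A \in so S).

Lemma quad_exp_gram s u w :
  gram S (quad_exp s *m u) w = gram S u (quad_exp (- s) *m w).
Proof.
move/soP: Aso => AS; rewrite /quad_exp !mulmxDl -!scalemxAl !mul1mx -!mulmxA.
by rewrite !gramE !AS opprK sqrrN mulNr mulrN.
Qed.

Lemma quad_exp_SO s : SO_group S (quad_exp s).
Proof.
(* Halving the parameter exhibits the element as the square of an orthogonal matrix. *)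
rewrite [s]splitr -quad_expD; apply: orthogonal_sqr_SO => //; apply/SOP => u w.
by rewrite quad_exp_gram mulmxA quad_expD addNr quad_exp0 mul1mx.
Qed.

End Unipotent.

(** * The one-parameter torus of a hyperbolic pair *)

Section Torus.
Variables (C : numClosedFieldType) (n : nat) (S : 'M[C]_n).
Hypotheses (symS : S^T = S) (unitS : S \in unitmx).
Variables (e f : 'cV[C]_n).
Local Notation gram := (gram S).
Hypotheses (ee : gram e e = 0) (ff : gram f f = 0) (ef0 : gram e f != 0).

(** Scales [e] by [r^-1] and [f] by [r], and fixes every vector orthogonal to both. *)
Definition torus r : 'M[C]_n :=
  1%:M + ((r^-1 - 1) / gram e f) *: (e *m (f^T *m S)) +
  ((r - 1) / gram e f) *: (f *m (e^T *m S)).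

Lemma torusE r u : torus r *m u =
  u + ((r^-1 - 1) / gram e f * gram f u) *: e +
      ((r - 1) / gram e f * gram e u) *: f.
Proof.
have outer s t : s *m (t^T *m S) *m u = gram t u *: s.
  by rewrite -mulmxA [_ *m u]mx11_scalar mul_mx_scalar.
by rewrite !mulmxDl mul1mx -!scalemxAl !outer !scalerA.
Qed.

Lemma torusM r t : r != 0 -> t != 0 -> torus r *m torus t = torus (r * t).
Proof.
move=> r0 t0; apply: mulmx_ext => u; rewrite -mulmxA !torusE.
rewrite !gramE ee ff (gramC symS f e).
by apply/colP => i; rewrite !mxE; field; rewrite r0 t0 ef0.
Qed.

Lemma torus1 : torus 1 = 1%:M.
Proof. by rewrite /torus invr1 subrr !mul0r !scale0r !addr0. Qed.

Lemma torus_SO r : r != 0 -> SO_group S (torus r).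
Proof.
move=> r0; rewrite -(sqrtCK r) expr2.
have s0 : sqrtC r != 0 by rewrite sqrtC_eq0.
rewrite -torusM //; apply: orthogonal_sqr_SO => //; apply/SOP => u w.
rewrite !torusE !gramE ee ff (gramC symS f e) (gramC symS u e) (gramC symS u f).
by field; rewrite s0 ef0.
Qed.

End Torus.

(** * Action of the nilradical in dimension at most four *)

Section DimensionFour.
Variables (C : numClosedFieldType) (n : nat) (S : 'M[C]_n).
Hypotheses (symS : S^T = S) (unitS : S \in unitmx).
Local Notation gram := (gram S).
Local Notation perp := (perp S).

(* perp e / e is a plane, on which a nilpotent skew operator vanishes. *)
Lemma nilpotent_dim4 (a : {vspace 'M[C]_n}) e u (U := <[e]>%VS) :
  e != 0 -> (U <= perp U)%VS -> u \in perp U -> u \notin U -> gram u u = 0 ->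
  (n <= 4)%N -> (a <= so S)%VS -> (a <= transporter U 0)%VS ->
  (a <= transporter (U + <[u]>) U)%VS -> (a <= transporter (perp U) U)%VS.
Proof.
move=> e0 isoU uU uU' uu n4 aS aU aL.
have aUU : (a <= transporter U U)%VS.
  by apply: subv_trans aU _; apply: transporter_mono; rewrite ?sub0v.
have /subvP aU' := perp_stable aS aUU.
apply/subvP => x xa; have /soP xS := subvP aS x xa.
have /transporterP xL := subvP aL x xa; have /transporterP xU' := aU' x xa.
apply/transporterP => w wU.
have [/xL//|wL] := boolP (w \in (U + <[u]>)%VS).
have eU : e \in U := memv_line e.
have uL : u \in (U + <[u]>)%VS by apply: (subvP (addvSr _ _)); apply: memv_line.
have LU : (U + <[u]> <= perp U)%VS by rewrite subv_add isoU -memvE.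
(* As a proper subspace [perp U] has dimension at most 3, so three independent vectors span it. *)
have perpE : (U + <[u]> + <[w]>)%VS = perp U.
  apply/eqP; rewrite eqEdim subv_add LU -memvE wU /=.
  have lt (y : 'cV[C]_n) (V : {vspace 'cV[C]_n}) : y \notin V ->
      (\dim V < \dim (V + <[y]>))%N.
    move=> yV; rewrite (ltn_leqif (dimv_leqif_sup (addvSl V <[y]>))).
    by apply: contra yV; rewrite subv_add -memvE => /andP[].
  apply: (@leq_trans 3%N); last first.
    apply: (leq_trans _ (lt _ _ wL)); rewrite ltnS.
    by apply: (leq_trans _ (lt _ _ uU')); rewrite dim_vline e0.
  have [t et] := gram_nondegenerate unitS e0.
  have tU : t \notin perp U by rewrite mem_perp_line et oner_eq0.
  rewrite -ltnS; apply: (leq_trans (lt _ _ tU)).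
  by rewrite (leq_trans (dimvS (subvf _))) // dimvf /dim /= muln1.
have uw : gram u w != 0.
  apply: contra uU' => /eqP uw; apply: (subvP (perp_perp symS unitS U)).
  by rewrite -perpE 2!mem_perp_addv_line uU uu eqxx /= (gramC symS w) uw eqxx.
have := xU' w wU; rewrite -perpE => /memv_addP[y].
case/memv_addP=> _ /vlineP[k ->] [_ /vlineP[l ->] ->] [_ /vlineP[m ->] xw].
have ew : gram e w = 0 by apply: (perpP _ _ _ wU).
have ue : gram u e = 0 by rewrite (gramC symS) (perpP _ _ _ uU).
(* Pairing [x *m w] with [u] kills the coefficient of [w]; pairing it with [w], which gives zero by
   skewness, then kills that of [u]. *)
have m0 : m = 0.
  have : gram u (x *m w) = 0.
    apply/eqP; rewrite -oppr_eq0 -xS; apply/eqP; apply: (perpP _ _ _ wU).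
    exact: xL.
  rewrite xw !gramE ue uu !mulr0 !add0r => /eqP.
  by rewrite mulf_eq0 (negPf uw) orbF => /eqP.
have l0 : l = 0.
  have := so_gram_self symS w (subvP aS x xa).
  rewrite xw m0 scale0r addr0 !gramE (gramC symS w e) ew mulr0 add0r => /eqP.
  by rewrite mulf_eq0 (gramC symS w) (negPf uw) orbF => /eqP.
by rewrite xw m0 l0 !scale0r !addr0 memvZ.
Qed.

End DimensionFour.

(** * Closed orbits: orthogonality to [v] and the common centralizer *)

Section ClosedOrbit.
Variables (C : numClosedFieldType) (n : nat) (S : 'M[C]_n) (v : 'cV[C]_n).
Variable b : {vspace 'M[C]_n}.
Hypotheses (symS : S^T = S) (unitS : S \in unitmx).
Local Notation gram := (gram S).
Local Notation perp := (perp S).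
Hypothesis vv : gram v v != 0.
Hypothesis borelb : borel_subalgebra (so S) b.
Hypothesis closedb :
  zariski_closed_in (borel_subalgebra (so S)) (SO_stabilizer_orbit S v b).

Section Flag.
Variables (U : {vspace 'cV[C]_n}) (e : 'cV[C]_n).
Let L := (U + <[e]>)%VS.
Hypotheses (isoU : (U <= perp U)%VS) (eU : e \in perp U) (ee : gram e e = 0).
Hypotheses (bU : (b <= transporter U U)%VS).
Hypotheses (be : (b <= transporter <[e]> L)%VS).
Hypotheses (eU' : e \notin U) (dimL : (\dim L * 2 < n)%N) (vU : v \in perp U).
Hypothesis stabU : forall p, SO_group S p -> adjoint_act p b = b ->
  forall u, u \in U -> p *m u \in U.

(** Passes stability under the stabilizer of [b] from [U] to [L], so that the orthogonality argument
    can be repeated with [L] as the next [U]. *)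
Lemma stabilizer_flag p : SO_group S p -> adjoint_act p b = b ->
  forall w, w \in L -> p *m w \in L.
Proof.
move=> SOp pb; apply: (flag_stable symS unitS isoU eU ee borelb bU be) => //.
  exact: stabU.
apply: stabU; first exact: SO_group_inv.
by rewrite -{1}pb adjointK // (SO_group_unit SOp).
Qed.

Let eL : e \in L.
Proof. by apply: (subvP (addvSr _ _)); apply: memv_line. Qed.

Let isoL : (L <= perp L)%VS := flag_isotropic symS isoU eU ee.

(** An anisotropic vector of [perp L] is scaled to the norm of [v]; adding a multiple of [e],
    isotropic and orthogonal to it, adjusts the pairing with [v] and keeps the norm. The difference
    [v - w] is then isotropic and orthogonal to [w]. *)
Lemma orthogonal_companion : gram e v != 0 ->
  exists w, [/\ w \in perp L, gram w w = gram v v & gram v w = gram v v].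
Proof.
move=> ev; have [w0 w0L w00] := perp_anisotropic symS unitS isoL dimL.
have [w1 w1L w1w1] : exists2 w1, w1 \in perp L & gram w1 w1 = gram v v.
  exists (sqrtC (gram v v / gram w0 w0) *: w0); rewrite ?memvZ //.
  by rewrite !gramE mulrA -expr2 sqrtCK divfK.
have ew1 : gram e w1 = 0 by apply: (perpP _ _ _ w1L).
exists (w1 + ((gram v v - gram v w1) / gram e v) *: e); split.
- by rewrite memvD // memvZ // (subvP isoL).
- by rewrite !gramE (gramC symS w1 e) ew1 ee w1w1 !(mulr0, addr0).
- by rewrite !gramE (gramC symS v e) divfK // addrC subrK.
Qed.

(* Otherwise a one-parameter unipotent group moves v, within its orbit under a
   torus of the stabilizer of b except at a single parameter value, to a vector
   orthogonal to e. By closedness the exceptional value stays in the orbit. *)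
Lemma closed_orbit_orthogonal : gram e v = 0.
Proof.
apply/eqP; apply: contraT => ev; have [w [wL ww vw]] := orthogonal_companion ev.
have [q qE] : exists q, q = gram v v by exists (gram v v).
have [f fE] : exists f, f = v - w by exists (v - w).
have q0 : q != 0 by rewrite qE.
rewrite -qE in ww vw.
have vE : v = w + f by rewrite fE addrC subrK.
have wv : gram w v = q by rewrite (gramC symS).
have ff : gram f f = 0 by rewrite fE !gramE -qE ww vw wv; ring.
have fw : gram f w = 0 by rewrite fE !gramE ww vw subrr.
have wf : gram w f = 0 by rewrite (gramC symS).
have ew : gram e w = 0 by apply: (perpP _ _ _ wL).
have ef : gram e f = gram e v by rewrite fE !gramE ew subr0.
have ef0 : gram e f != 0 by rewrite ef.
have fv : gram f v = 0 by rewrite vE gramE fw ff addr0.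
have fU u : u \in U -> gram f u = 0.
  move=> uU; rewrite fE !gramE (gramC symS v) (perpP _ _ _ vU) // (gramC symS w).
  by rewrite (perpP _ _ _ wL) ?subr0 // (subvP (addvSl _ _)).
(* This bivector kills [f] and maps [w] to a multiple of [f], so its cube is zero and its
   exponentials change [v] only by multiples of [f]. *)
have [A AE] : exists A, A = wedge S f w by exists (wedge S f w).
have Aso : A \in so S by rewrite AE; apply: wedge_so.
have Af : A *m f = 0 by rewrite AE wedgeE wf ff !scale0r subrr.
have Aw : A *m w = q *: f by rewrite AE wedgeE fw scale0r subr0 ww.
have A3 : A *m A *m A = 0.
  apply: mulmx_ext => t; rewrite mul0mx -!mulmxA {3}AE wedgeE.
  rewrite [A *m (_ - _)]mulmxBr -!scalemxAr Af Aw scaler0 sub0r mulmxN.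
  by rewrite -!scalemxAr Af !scaler0 oppr0.
have Ev s : quad_exp A s *m v = w + (1 + s * q) *: f.
  have Av : A *m v = q *: f by rewrite vE mulmxDr Af Aw addr0.
  rewrite /quad_exp !mulmxDl mul1mx -!scalemxAl -mulmxA Av -scalemxAr Af !scaler0 addr0.
  by rewrite {1}vE scalerA scalerDl scale1r addrA.
have E0 s : quad_exp A (- s) *m quad_exp A s = 1%:M.
  by rewrite quad_expD // addNr quad_exp0.
have SOE s : SO_group S (quad_exp A s) by apply: quad_exp_SO.
have uE s : quad_exp A s \in unitmx := SO_group_unit (SOE s).
have SOT r : r != 0 -> SO_group S (torus S e f r) by apply: torus_SO.
(* The torus fixes [U] pointwise, since [e] and [f] are orthogonal to [U]; it preserves [L] and is
   trivial on [perp L] modulo [L]. *)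
have torus_b r : r != 0 -> adjoint_act (torus S e f r) b = b.
  move=> r0; have r0' : r^-1 != 0 by rewrite invr_eq0.
  apply: (@flag_radical_group_adjoint _ _ _ symS _ _ _ isoU eU ee borelb bU be _
            (torus S e f r^-1)); last by rewrite torusM // mulfV // torus1.
  have T t : t != 0 -> [/\ SO_group S (torus S e f t),
      forall u, u \in U -> torus S e f t *m u = u,
      forall w, w \in L -> torus S e f t *m w \in L &
      forall w, w \in perp L -> torus S e f t *m w - w \in L].
    move=> t0; split=> [|u uU|u uL|u uL]; rewrite ?torusE; first exact: SOT.
    - have eu : gram e u = 0 by rewrite (gramC symS) (perpP _ _ _ eU).
      by rewrite fU // eu !mulr0 !scale0r !addr0.
    - rewrite (perpP _ _ _ (subvP isoL _ uL) e eL) mulr0 scale0r addr0.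
      by rewrite memvD ?memvZ.
    - rewrite (perpP _ _ _ uL e eL) mulr0 scale0r addr0 addrC addKr.
      by rewrite memvZ.
  by move=> g [] ->; apply: T.
have Tv r : torus S e f r *m v = w + r *: f.
  rewrite torusE fv mulr0 scale0r addr0 -ef divfK // {1}vE.
  by rewrite -addrA scalerBl scale1r [f + _]addrC subrK.
(* For [r = 1 + s * q] the torus and the unipotent element move [v] to the same vector; the excluded
   parameter is the one with [r = 0]. *)
have orbit s : s != - q^-1 ->
    SO_stabilizer_orbit S v b (adjoint_act (quad_exp A (- s)) b).
  move=> sq; have r0 : 1 + s * q != 0.
    apply: contra sq => /eqP; rewrite addrC => /eqP.
    rewrite addr_eq0 => /eqP sq; apply/eqP.
    by rewrite -[LHS](mulfK q0) sq mulN1r.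
  exists (quad_exp A (- s) *m torus S e f (1 + s * q)).
  split; last by rewrite adjointM ?torus_b // (SO_group_unit (SOT _ r0)).
  split; first by apply: SO_group_mul => //; apply: SOT.
  by rewrite -mulmxA Tv -Ev mulmxA E0 mul1mx.
have [|||k [[SOk kv] Ek]] := @zariski_closed_line _ _ _ _ b
  (quad_exp_poly A (-1)) (quad_exp_poly A 1) (- q^-1) closedb.
- by move=> s; rewrite !evmx_quad_exp mulN1r mul1r E0.
- by move=> s; rewrite evmx_quad_exp; apply: borel_adjoint.
- by move=> s; rewrite evmx_quad_exp mulN1r; apply: orbit.
rewrite evmx_quad_exp mulrNN mul1r in Ek.
(* Closedness provided [k] at the exceptional parameter, where the unipotent element sends [v] to
   [w]. Hence [p] stabilizes [b] and takes [v] to [w]. *)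
pose p := quad_exp A (- q^-1) *m k.
have SOp : SO_group S p by apply: SO_group_mul.
have up := SO_group_unit SOp; have uk := SO_group_unit SOk.
have pb : adjoint_act p b = b.
  rewrite adjointM // -Ek -adjointM // E0.
  by apply/vspaceP => x; rewrite adjointE ?unitmx1 // invmx1 mul1mx mulmx1.
have pv : p *m v = w.
  by rewrite -mulmxA kv Ev mulNr mulVf // subrr scale0r addr0.
have SOp' := SO_group_inv SOp.
have pb' : adjoint_act (invmx p) b = b by rewrite -{1}pb adjointK.
(* With [invmx p *m e] written as [u + c *: e], its pairing with [v] equals that of [e] with [w],
   which is zero. So [c = 0] and [e] lies in [U], a contradiction. *)
have := stabilizer_flag SOp' pb' eL.
case/memv_addP => u uU [_ /vlineP[c ->] pe].
have : gram (invmx p *m e) v = 0.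
  have /SOP <- : p^T *m S *m p = S by case: SOp.
  by rewrite mulKVmx // pv.
rewrite pe gramE (gramC symS u) (gramC symS v) (perpP _ _ _ vU) // add0r gramE.
move/eqP; rewrite mulf_eq0 (negPf ev) orbF => /eqP c0.
case/negP: eU'; rewrite -(mulKVmx up e) pe c0 scale0r addr0.
exact: stabU.
Qed.

End Flag.

(** The bracket with [x] acts on the bivector as a derivation; [x] kills [e] and maps [w] into the
    line of [e], so both terms vanish. Orthogonality of [e] and [w] to [v] puts the bivector in
    [k]. *)
Lemma wedge_centralizes e w (U := <[e]>%VS) :
  gram e v = 0 -> gram w v = 0 -> e != 0 -> w \notin U ->
  (lie_prod b b <= transporter U 0)%VS ->
  (lie_prod b b <= transporter <[w]> U)%VS ->
  let k := so_annihilator S v in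
  (lie_centralizer k (lie_prod b b :&: k) :&:
   lie_centralizer (so S) (lie_prod b b))%VS <> 0%VS.
Proof.
move=> ev wv e0 wU /subvP be /subvP bw k E; have [bS sb _ _] := borelb.
pose z := wedge S e w.
have zS : z \in so S by apply: wedge_so.
have zk : z \in k by rewrite mem_so_annihilator zS wedgeE ev wv !scale0r subrr eqxx.
have zx x : x \in lie_prod b b -> lie_bracket z x = 0.
  move=> xb; have /soP xS : x \in so S by apply/(subvP bS)/(subvP sb).
  have xe : x *m e = 0.
    have /transporterP/(_ e (memv_line e)) := be x xb.
    by rewrite memv0 => /eqP.
  have /transporterP/(_ w (memv_line w))/vlineP[c xw] := bw x xb.
  apply: mulmx_ext => t; rewrite lie_bracket_mul mul0mx !wedgeE mulmxBr.
  have -> : gram w (x *m t) = - (c * gram e t).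
    by rewrite -gramZl -xw xS opprK.
  have -> : gram e (x *m t) = 0 by rewrite -[LHS]opprK -xS xe gramE oppr0.
  rewrite -!scalemxAr xe xw scaler0 scale0r subr0 sub0r opprK.
  by rewrite scalerA scaleNr mulrC addNr.
have : z \in 0%VS.
  rewrite -E memv_cap; apply/andP; split; apply/mem_lie_centralizer; split=> //.
  by move=> x /memv_capP[/zx].
rewrite memv0 => /eqP z0; have [t et] := gram_nondegenerate unitS e0.
case/negP: wU; have := wedgeE S e w t; rewrite -/z z0 mul0mx et scale1r.
move/esym/eqP; rewrite subr_eq0 => /eqP <-; exact/memvZ/memv_line.
Qed.

Lemma closed_orbit_centralizers : (3 < n)%N ->
  let k := so_annihilator S v in
  (lie_centralizer k (lie_prod b b :&: k) :&:
   lie_centralizer (so S) (lie_prod b b))%VS <> 0%VS.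
Proof.
move=> n3; have [bS sb solb _] := borelb.
have b0 : (b <= transporter 0 0)%VS.
  apply/subvP => x _; apply/transporterP => u.
  by rewrite memv0 => /eqP->; rewrite mulmx0 mem0v.
have perp0 u : u \in perp 0.
  by apply/perpP => t; rewrite memv0 => /eqP->; rewrite gramE.
have [|e [_ eU ee be]] := isotropic_weight_vector symS bS sb solb b0.
  by rewrite dimv0 (leq_trans _ n3).
have e0 : e != 0 by rewrite -memv0.
have iso0 : (0 <= perp 0)%VS by apply: sub0v.
have stab0 p : SO_group S p -> adjoint_act p b = b ->
    forall u : 'cV[C]_n, u \in 0%VS -> p *m u \in 0%VS.
  by move=> _ _ u; rewrite !memv0 => /eqP->; rewrite mulmx0.
have dim0 : (\dim (0 + <[e]>) * 2 < n)%N.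
  by rewrite add0v dim_vline e0 (leq_trans _ n3).
(* First pass, starting from the zero subspace. *)
have ev := closed_orbit_orthogonal iso0 (perp0 e) ee b0 be eU dim0 (perp0 v) stab0.
have stab1 := stabilizer_flag iso0 (perp0 e) ee b0 be eU dim0 stab0.
have nb0 := lie_prod_transporter_line b0 be.
have b1 := transporter_addl b0 be.
have iso1 := flag_isotropic symS iso0 (perp0 e) ee.
move: dim0 stab1 nb0 b1 iso1; rewrite {be} add0v.
set U := <[e]>%VS => dim1 stab1 nb0 b1 iso1.
have dimU : \dim U = 1%N by rewrite dim_vline e0.
have vU : v \in perp U by rewrite mem_perp_line ev.
have [|u [uU uU' uu bu]] := isotropic_weight_vector symS bS sb solb b1.
  by rewrite dimU.
have nb1 := lie_prod_transporter_line b1 bu.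
have nbu : (lie_prod b b <= transporter <[u]> U)%VS.
  by apply: subv_trans nb1 _; apply: transporter_mono; rewrite ?addvSr.
case: (ltnP 4 n) => [n4|n4].
  (* For [n > 4] the flag with [u] added still satisfies the dimension bound, and a second pass
     makes [u] orthogonal to [v]. *)
  apply: (wedge_centralizes ev _ e0 uU' nb0 nbu).
  apply: closed_orbit_orthogonal iso1 uU uu b1 bu uU' _ vU stab1.
  apply: leq_ltn_trans n4; rewrite (leq_mul2r 2 _ 2) /=.
  by rewrite (leq_trans (dimv_add_leqif _ _)) // dimU dim_vline; case: (u != 0).
(* For [n = 4] the vectors orthogonal to both [e] and [v] form a space of dimension at least 2, so
   one of them lies outside the line of [e]. *)
have /subvPn[w wUv wU] : ~~ (perp (U + <[v]>) <= U)%VS.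
  apply/negP => /dimvS; rewrite dimU.
  have d3 := dim_perp S (U + <[v]>); move=> d1.
  have d2 : (\dim (U + <[v]>) <= 2)%N.
    by rewrite (leq_trans (dimv_add_leqif _ _)) // dimU dim_vline; case: (v != 0).
  by have := leq_trans (leq_trans n3 d3) (leq_add d1 d2).
move: wUv; rewrite mem_perp_addv_line => /andP[wp /eqP vw].
apply: (wedge_centralizes ev _ e0 wU nb0); first by rewrite (gramC symS).
apply: (subv_trans _ (transporter_mono _ (subvv U))); last by rewrite -memvE; apply: wp.
apply: (nilpotent_dim4 symS unitS e0 iso1 uU uU' uu) => //.
exact: subv_trans sb bS.
Qed.

End ClosedOrbit.

Theorem proposition4p24 (R : realType) (n : nat) (S : 'M[R[i]]_n)
    (v : 'cV[R[i]]_n) (b : {vspace 'M[R[i]]_n}) :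
  (3 < n)%N ->
  S^T = S -> S \in unitmx ->
  v^T *m S *m v != 0 ->
  borel_subalgebra (so S) b ->
  zariski_closed_in (borel_subalgebra (so S)) (SO_stabilizer_orbit S v b) ->
  let g := so S in
  let k := so_annihilator S v in
  let nb := lie_prod b b in
  (lie_centralizer k (nb :&: k) :&: lie_centralizer g nb)%VS <> 0%VS.
Proof.
move=> n3 symS unitS vv borelb closedb; apply: closed_orbit_centralizers => //.
by apply: contra vv => /eqP gv; rewrite [_ *m v]mx11_scalar -/(gram S v v) gv raddf0.
Qed.
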